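(* Let $\theta$ be an irrational real number and let $\mu$ be its irrationality exponent. Let $(p_k/q_k)_{k\ge1}$ denote the sequence of convergents to $\theta$, and let $S$ be a finite set of prime numbers. If $\mu$ is finite, then for every $\varepsilon>0$ and every sufficiently large $k$ (depending on $\varepsilon$) we have $$[q_{k-1}q_kq_{k+1}]_S<(q_{k-1}q_kq_{k+1})^{\mu/(\mu+1)+\varepsilon}.$$ The same conclusion holds when the sequence $(q_k)_{k\ge1}$ is replaced by $(|p_k|)_{k\ge1}$, i.e. for every $\varepsilon>0$ and all sufficiently large $k$, $[|p_{k-1}p_kp_{k+1}|]_S<|p_{k-1}p_kp_{k+1}|^{\mu/(\mu+1)+\varepsilon}$.
   Context: For a non-zero integer $N$, $[N]_S$ denotes the largest positive divisor of $N$ composed solely of primes from $S$; $[0]_S=0$. The irrationality exponent $\mu(\theta)$ of an irrational real $\theta$ is the supremum of real $\mu$ such that there exist infinitely many rationals $r/s$ with $s\ge1$ and $|\theta-r/s|<s^{-\mu}$; it is at least $2$ and may be $+\infty$. *)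

(* Defs.v *)
From HB Require Import structures.
From mathcomp Require Import all_boot all_order all_algebra finmap.
From mathcomp Require Import all_classical all_reals all_analysis.

Set Implicit Arguments.
Unset Strict Implicit.
Unset Printing Implicit Defensive.

Import Order.TTheory GRing.Theory Num.Theory.
Import numFieldNormedType.Exports.

Local Open Scope classical_set_scope.
Local Open Scope ring_scope.

(* [N]_S. The case N = 0 is separate because 0`_pi = 1 in MathComp. *)
Definition Spart (S : {fset nat}) (N : int) : nat :=
  if N == 0 then 0%N else ((absz N)`_[pred p in S])%N.

(* The set below consists of rational numbers, not of pairs (r, s), so
   different representations of one rational are not counted separately. *)
Definition irrationality_exponent (R : realType) (theta : R) : \bar R :=
  ereal_sup [set mu%:E | mu in [set mu : R |
    infinite_set [set x : rat | exists (r : int) (s : nat),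
      [/\ (1 <= s)%N, x = r%:~R / s%:R
        & `|theta - r%:~R / s%:R| < s%:R `^ (- mu)]]]].

(* The value of [a_0; a_1, ..., a_k], where a_0, a_1, ... are the partial
   quotients of theta. For irrational theta no division by zero occurs. *)
Fixpoint convergent (R : realType) (theta : R) (k : nat) : rat :=
  let a0 := Num.floor theta in
  if k is k'.+1 then a0%:~R + (convergent (theta - a0%:~R)^-1 k')^-1
  else a0%:~R.

Definition conv_num (R : realType) (theta : R) (k : nat) : int :=
  numq (convergent theta k).

Definition conv_den (R : realType) (theta : R) (k : nat) : int :=
  denq (convergent theta k).

(* Main.v *)
(* Let x > y > 0 be coprime integers. By Ridout's theorem for the three targets
   0, 1 and infinity, the S-part of x y (x - y) is less than x y x^delta outside
   a finite set. Take x = q_(k+1) / g and y = q_(k-1) / g, where g is the gcd of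
   q_(k+1) and q_(k-1): then q_k divides x - y, and the S-part of
   q_(k-1) q_k q_(k+1) is less than q_(k-1) q_(k+1)^(1+delta). Since
   q_(k+1) <= q_k^(mu-1+eta) for large k, this is the claimed bound. The |p_k|
   satisfy the same recurrence and have the same growth.

   Ridout's theorem for rational targets follows from Roth's method. Siegel's
   lemma gives an integer polynomial in m variables of degrees d_1, ..., d_m,
   whose monomials X^i all have sum_j i_j / d_j close to m / 2 and which vanishes
   at (1, ..., 1) to weighted order about m / 2. By Roth's lemma some Taylor
   coefficient of low order at (x_1 / y_1, ..., x_m / y_m) is non-zero, for
   exceptional pairs (x_j, y_j) of fast increasing heights, all with about the
   same p-adic behaviour. After clearing denominators it is a non-zero integer
   whose S-part would exceed its absolute value. *)

Require Import Defs.
From mathcomp Require Import all_boot all_order all_algebra finmap.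
From mathcomp Require Import all_classical all_reals all_analysis.
From mathcomp Require Import perm ring lra zify.
Import Order.TTheory GRing.Theory Num.Theory.
Import numFieldNormedType.Exports.
Local Open Scope classical_set_scope.
Local Open Scope ring_scope.

(** All estimates are logarithmic. In a class of exceptional pairs, ln y <= s ln x, and each prime q
    of S divides at most one of x, y, x - y, to a power of size at least x^al_q, where the al_q sum
    to at least 1 + s + delta. The degrees d_j are chosen so that every x_j^d_j is about e^D. After
    homogenization by powers of the y_j, a monomial of weight m / 2 then has size about e^((1 + s) D
    m / 2).

    Centring at m / 2 puts the three targets on the same footing: the exponents of the x_j, those of
    the y_j and the order of vanishing at (1, ..., 1) all have weight about m / 2. So the integer is
    divisible by a number of size about e^((1 + s + delta) D m / 2), whichever target each prime
    has. The law of large numbers for the i_j / d_j pays for this: almost all monomials are central,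
    while the vanishing conditions are few.

    The exponent mu / (mu + 1) arises because the product of the three terms is at most about the
    power mu + 1 of the middle one, while its part prime to S is at least about the middle term
    itself. *)

Section Ridout.
Set Implicit Arguments.
Unset Strict Implicit.
Variable R : realType.

(** * Iterated polynomials and generalized Wronskians *)

(* The head of a list of degrees, weights, exponents or points always belongs to
   the outermost variable, which in Roth's lemma is the one of least degree. *)
Fixpoint mvpoly (m : nat) : idomainType :=
  if m is m'.+1 then {poly mvpoly m'} : idomainType else R : idomainType.

Fixpoint cst (m : nat) : {rmorphism R -> mvpoly m} :=
  if m is m'.+1 return {rmorphism R -> mvpoly m}
  then (polyC \o cst m' : {rmorphism R -> mvpoly m'.+1})
  else (idfun : {rmorphism R -> mvpoly 0}).

(* The Hasse derivative: dividing by the factorials keeps the coefficients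
   integral and of size at most exponential in the degree. *)
Fixpoint hasse (m : nat) (a : seq nat) : {additive mvpoly m -> mvpoly m} :=
  if m is m'.+1 return {additive mvpoly m -> mvpoly m}
  then (map_poly (hasse m' (behead a)) \o nderivn (head 0%N a)
         : {additive mvpoly m'.+1 -> mvpoly m'.+1})
  else (idfun : {additive mvpoly 0 -> mvpoly 0}).

Fixpoint partial (m j : nat) : {additive mvpoly m -> mvpoly m} :=
  if m is m'.+1 return {additive mvpoly m -> mvpoly m}
  then if j is j'.+1
       then (map_poly (partial m' j') : {additive mvpoly m'.+1 -> mvpoly m'.+1})
       else (deriv : {additive mvpoly m'.+1 -> mvpoly m'.+1})
  else (\0 : {additive mvpoly 0 -> mvpoly 0}).

Lemma cstS m c : cst m.+1 c = (cst m c)%:P.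
Proof. by []. Qed.

Lemma hasseS m a (F : mvpoly m.+1) :
  hasse m.+1 a F = map_poly (hasse m (behead a)) (F^`N(head 0%N a)).
Proof. by []. Qed.

Lemma coef_hasseS m a (F : mvpoly m.+1) i :
  (hasse m.+1 a F)`_i =
  hasse m (behead a) (F`_(head 0%N a + i) *+ 'C(head 0%N a + i, head 0%N a)).
Proof. by rewrite hasseS coef_map coef_nderivn. Qed.

Lemma hasse_cstM m a c (F : mvpoly m) : hasse m a (cst m c * F) = cst m c * hasse m a F.
Proof.
elim: m a F => [|m IH] a F //.
apply/polyP => i; rewrite coef_hasseS cstS !coefCM coef_hasseS.
by rewrite -mulrnAr IH.
Qed.

Lemma partialM m j (F G : mvpoly m) : partial m j (F * G) = partial m j F * G + F * partial m j G.
Proof.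
elim: m j F G => [|m IH] [|j] F G /=; rewrite ?mul0r ?mulr0 ?addr0 //.
  by rewrite derivM.
apply/polyP => i; rewrite coefD !coefM coef_map /= coefM raddf_sum -big_split.
by apply: eq_bigr => k _; rewrite IH !coef_map.
Qed.

Lemma hasse0 m (F : mvpoly m) : hasse m [::] F = F.
Proof.
elim: m F => [|m IH] F //; apply/polyP => i.
by rewrite coef_hasseS /= add0n bin0 IH.
Qed.

(** The Wronskian argument differentiates relations between Hasse derivatives; there the integer
    factor multiplies a vanishing sum and drops out. *)
Lemma partial_hasse m j a (F : mvpoly m) : (j < m)%N ->
  partial m j (hasse m a F) = hasse m (incr_nth a j) F *+ (nth 0%N a j).+1.
Proof.
elim: m j a F => [|m IH] [|j] a F // hj; apply/polyP => i; rewrite coefMn.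
- have -> : (partial m.+1 0 (hasse m.+1 a F))`_i = (hasse m.+1 a F)`_i.+1 *+ i.+1.
    by rewrite /= coef_deriv.
  rewrite !coef_hasseS -[LHS]raddfMn -[RHS]raddfMn /= -!mulrnA.
  have -> : head 0%N (incr_nth a 0) = (nth 0%N a 0).+1 by case: a.
  have -> : behead (incr_nth a 0) = behead a by case: a.
  have -> : head 0%N a = nth 0%N a 0 by case: a.
  set k := nth 0%N a 0.
  rewrite addSnnS; congr (hasse _ _ (_ *+ _)).
  by have := mul_bin_left (k + i.+1) k; rewrite addKn => h; rewrite [RHS]mulnC h mulnC.
- have -> : (partial m.+1 j.+1 (hasse m.+1 a F))`_i = partial m j (hasse m.+1 a F)`_i.
    by rewrite /= coef_map.
  rewrite !coef_hasseS IH //.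
  have -> : head 0%N (incr_nth a j.+1) = head 0%N a by case: a.
  have -> : behead (incr_nth a j.+1) = incr_nth (behead a) j.
    by case: a => //=; case: j {IH hj}.
  by have -> : nth 0%N (behead a) j = nth 0%N a j.+1 by case: a => //=; rewrite nth_nil.
Qed.

Lemma coefM_top (A : idomainType) (p q : {poly A}) k n :
  (size p <= k.+1)%N -> (size q <= n.+1)%N -> (p * q)`_(k + n) = p`_k * q`_n.
Proof.
move=> hp hq; rewrite coefM.
have hk : (k < (k + n).+1)%N by lia.
rewrite (bigD1 (Ordinal hk)) //= addKn big1 ?addr0 // => i /eqP hi.
have hik : (i : nat) <> k by move=> h; apply: hi; apply/val_inj.
have [h|h] := ltnP i k.
- by rewrite [q`_ _]nth_default ?mulr0 //; apply: leq_trans hq _; lia.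
- by rewrite [p`_ _]nth_default ?mul0r //; apply: leq_trans hp _; lia.
Qed.

Lemma mp_natr_eq0 m (n : nat) : (n%:R == 0 :> mvpoly m) = (n == 0%N).
Proof. by rewrite -(rmorph_nat (cst m)) fmorph_eq0 pnatr_eq0. Qed.

Lemma size_logderiv m (A B : mvpoly m.+1) : A != 0 -> B != 0 ->
  B * A^`() = A * B^`() -> size (A : {poly _}) = size (B : {poly _}).
Proof.
move=> A0 B0 h.
have [a sA] : exists a, size (A : {poly _}) = a.+1.
  by exists (size (A : {poly _})).-1; rewrite prednK // size_poly_gt0.
have [b sB] : exists b, size (B : {poly _}) = b.+1.
  by exists (size (B : {poly _})).-1; rewrite prednK // size_poly_gt0.
have la : (A : {poly _})`_a != 0 by have := A0; rewrite -lead_coef_eq0 lead_coefE sA.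
have lb : (B : {poly _})`_b != 0 by have := B0; rewrite -lead_coef_eq0 lead_coefE sB.
have XdE (P : {poly mvpoly m}) i : ('X * P^`())`_i = P`_i *+ i.
  by rewrite coefXM coef_deriv; case: i.
have sXd (P : {poly mvpoly m}) n : (size P <= n.+1)%N -> (size ('X * P^`())%R <= n.+1)%N.
  by move=> hP; apply/leq_sizeP => j hj; rewrite XdE nth_default ?mul0rn //; exact: leq_trans hP hj.
(* The factor ['X] makes the derivative keep the degree and multiplies the leading coefficient by
   it. Comparing the coefficients at [b + a] gives a = b, by characteristic 0. *)
have /(congr1 (fun P : {poly _} => P`_(b + a))) : B * ('X * A^`()) = A * ('X * B^`()).
  by rewrite mulrCA h mulrCA.
rewrite coefM_top ?sB // ?sXd ?sA // [(b + a)%N]addnC coefM_top ?sA // ?sXd ?sB //.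
rewrite !XdE !mulrnAr [B`_b * _]mulrC => E.
have ab0 : A`_a * B`_b != 0 by rewrite mulf_neq0.
have [l|l|l] := ltngtP b a.
- move: (congr1 (fun z => z - A`_a * B`_b *+ b) E); rewrite subrr -mulrnBr 1?ltnW // => /eqP.
  by rewrite -mulr_natr mulf_eq0 (negPf ab0) mp_natr_eq0 subn_eq0 leqNgt l.
- move: (congr1 (fun z => z - A`_a * B`_b *+ a) E); rewrite subrr -mulrnBr 1?ltnW // => /esym/eqP.
  by rewrite -mulr_natr mulf_eq0 (negPf ab0) mp_natr_eq0 subn_eq0 leqNgt l.
by rewrite l.
Qed.

(** A quotient whose partial derivatives all vanish is constant. To avoid fractions, the leading
    coefficients are proportional by induction, with factor c; the remainder A - c B satisfies the
    same relation in the outer variable, so by [size_logderiv] it has the degree of B unless it is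
    0, but its coefficient in that degree vanishes. *)
Lemma proportional m (A B : mvpoly m) : B != 0 ->
  (forall j, (j < m)%N -> B * partial m j A = A * partial m j B) ->
  exists c, A = cst m c * B.
Proof.
elim: m A B => [|m IH] A B B0 h.
  by exists ((A : R) / (B : R)); rewrite /= divfK.
have [->|A0] := eqVneq A 0; first by exists 0; rewrite rmorph0 mul0r.
have sAB : size (A : {poly _}) = size (B : {poly _}).
  by apply: size_logderiv => //; exact: (h 0%N).
have [n sB] : exists n, size (B : {poly _}) = n.+1.
  by exists (size (B : {poly _})).-1; rewrite prednK // size_poly_gt0.
have sA := sAB; rewrite sB in sA.
have lb : (B : {poly _})`_n != 0 by have := B0; rewrite -lead_coef_eq0 lead_coefE sB.
have smap (f : {additive mvpoly m -> mvpoly m}) (P : {poly mvpoly m}) k :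
    (size P <= k)%N -> (size (map_poly f P) <= k)%N.
  by move=> hP; apply/leq_sizeP => j hj; rewrite coef_map nth_default ?raddf0 //; exact: leq_trans hP hj.
have [c hc] : exists c, (A : {poly _})`_n = cst m c * (B : {poly _})`_n.
  apply: IH => // j hj; have /(congr1 (fun P : {poly _} => P`_(n + n))) := h j.+1 hj.
  by rewrite /= !coefM_top ?sA ?sB ?smap ?sA ?sB // !coef_map.
exists c; set r := A - cst m.+1 c * B.
suff : r = 0 by move/subr0_eq.
apply/eqP; apply: contraT => r0.
have : size (r : {poly _}) = size (B : {poly _}).
  apply: size_logderiv => //; have := h 0%N isT; rewrite /= => h0.
  have -> : r^`() = A^`() - cst m.+1 c * B^`().
    by rewrite /r derivB derivM cstS derivC mul0r add0r.
  rewrite mulrBr mulrBl h0; congr (_ - _).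
  by rewrite mulrCA mulrA.
have : (size (r : {poly _}) <= n)%N.
  apply/leq_sizeP => j; rewrite leq_eqVlt => /predU1P[<-|hj].
    by rewrite /r coefB cstS coefCM hc subrr.
  by rewrite /r coefB cstS coefCM !nth_default ?mulr0 ?subrr // ?sA ?sB.
by rewrite sB => + E; rewrite E ltnn.
Qed.

Lemma sumn_incr_nth (a : seq nat) j : sumn (incr_nth a j) = (sumn a).+1.
Proof.
elim: a j => [|k a IH] [|j] //=; last by rewrite IH addnS.
by rewrite sumn_ncons.
Qed.

Lemma det_neq0_ker (A : idomainType) n (M : 'M[A]_n) (v : 'I_n -> A) :
  \det M != 0 -> (forall i, \sum_j M i j * v j = 0) -> forall j, v j = 0.
Proof.
move=> dM h j; pose V := \col_j v j.
have MV : M *m V = 0.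
  by apply/colP => i; rewrite !mxE -[RHS](h i); apply: eq_bigr => k _; rewrite !mxE.
have : \adj M *m (M *m V) = 0 by rewrite MV mulmx0.
rewrite mulmxA mul_adj_mx mul_scalar_mx => /colP/(_ j); rewrite !mxE => /eqP.
by rewrite mulf_eq0 (negPf dM) => /eqP.
Qed.

Definition free_family {m l} (f : 'I_l -> mvpoly m) :=
  forall c : 'I_l -> R, \sum_i cst m (c i) * f i = 0 -> forall i, c i = 0.

(** The first l functions have a non-zero Wronskian. If no further row of order at most l made the
    larger one non-zero, its cofactors along that row would satisfy a linear relation with all these
    derivatives. Differentiating the relation shows that the quotients of the cofactors are
    constants, which contradicts freeness. *)
Lemma generalized_wronskian m l (f : 'I_l -> mvpoly m) : free_family f ->
  exists a : 'I_l -> seq nat, (forall i, (sumn (a i) <= i)%N) /\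
    \det (\matrix_(i, j) hasse m (a i) (f j)) != 0.
Proof.
elim: l f => [|l IH] f frf.
  by exists (fun=> [::]); split=> [[]//|]; rewrite det_mx00 oner_neq0.
have [|a [ha D0]] := IH (fun i => f (lift ord_max i)).
  move=> c hc i.
  have := frf (fun j => if unlift ord_max j is Some k then c k else 0).
  rewrite big_ord_recr /= unlift_none rmorph0 mul0r addr0 => H.
  have /H/(_ (lift ord_max i)) : \sum_(i0 < l)
     cst m (if unlift ord_max (widen_ord (leqnSn l) i0) is Some k then c k else 0) *
     f (widen_ord (leqnSn l) i0) = 0.
    rewrite -[RHS]hc; apply: eq_bigr => j _.
    have -> : widen_ord (leqnSn l) j = lift ord_max j.
      by apply/val_inj; rewrite /= /bump leqNgt ltn_ord.
    by rewrite liftK.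
  by rewrite liftK.
pose M b := \matrix_(i < l.+1, j < l.+1)
   hasse m (if unlift ord_max i is Some k then a k else b) (f j).
pose A j := cofactor (M [::]) ord_max j.
have cofE b j : cofactor (M b) ord_max j = A j.
  rewrite /A /cofactor; congr (_ * \det _).
  by apply/matrixP => u v; rewrite !mxE liftK.
have detE b : \det (M b) = \sum_j hasse m b (f j) * A j.
  rewrite (expand_det_row _ ord_max); apply: eq_bigr => j _.
  by rewrite cofE mxE unlift_none.
apply: contrapT => hn.
have rel b : (sumn b <= l)%N -> \sum_j hasse m b (f j) * A j = 0.
  move=> hb; rewrite -detE; apply/eqP; apply: contraT => hd; case: hn.
  exists (fun i => if unlift ord_max i is Some k then a k else b); split=> // i.
  case: unliftP => [k ->|->//]; rewrite /= /bump [(l <= k)%N]leqNgt ltn_ord.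
  exact: ha.
have Amax : A ord_max != 0.
  have -> : A ord_max = \det (\matrix_(i, j) hasse m (a i) (f (lift ord_max j))).
    rewrite /A /cofactor addnn -signr_odd odd_double mul1r; congr (\det _).
    by apply/matrixP => u v; rewrite !mxE liftK.
  exact: D0.
have Aprop j : exists c, A j = cst m c * A ord_max.
  apply: proportional => // u hu.
  case: (unliftP ord_max j) => [k ->|->]; last by [].
  (* Up to the square of [A ord_max], this is the derivative of the quotient of [A i] by
     [A ord_max]. The non-singular minor of order l will force it to vanish. *)
  pose c i := A ord_max * partial m u (A i) - A i * partial m u (A ord_max).
  suff H : forall k, c (lift ord_max k) = 0 by apply/subr0_eq; exact: H.
  apply: (det_neq0_ker D0) => i; under eq_bigr do rewrite mxE.
  have hai : (sumn (a i) < l)%N by apply: leq_ltn_trans (ha i) _.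
  (* Row [a i] has order less than l, so the relation holds for it and for its derivative; the
     product rule leaves only the terms where the cofactors are differentiated. *)
  have r1 : \sum_j hasse m (a i) (f j) * partial m u (A j) = 0.
    have /(congr1 (partial m u)) := rel (a i) (ltnW hai).
    rewrite raddf_sum raddf0.
    under eq_bigr do rewrite partialM partial_hasse // mulrnAl.
    rewrite big_split /= sumrMnl rel ?mul0rn ?add0r //.
    by rewrite sumn_incr_nth.
  have : \sum_j hasse m (a i) (f j) * c j = 0.
    under eq_bigr do rewrite /c mulrBr mulrCA [X in _ - X]mulrA.
    rewrite sumrB -mulr_sumr r1 mulr0 -mulr_suml.
    by rewrite (rel _ (ltnW hai)) mul0r subrr.
  rewrite big_ord_recr /= {2}/c subrr mulr0 addr0 => E.
  rewrite -[RHS]E; apply: eq_bigr => v _.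
  suff -> : widen_ord (leqnSn l) v = lift ord_max v by [].
  by apply/val_inj; rewrite /= /bump leqNgt ltn_ord.
have [c hc] := choice Aprop.
have /eqP : \sum_j (cst m (c j) * f j) * A ord_max = 0.
  apply: (etrans _ (rel [::] (leq0n _))).
  apply: eq_bigr => j _.
  by rewrite hasse0 -mulrA mulrCA -hc.
rewrite -mulr_suml mulf_eq0 (negPf Amax) orbF => /eqP/frf/(_ ord_max) c0.
by move: Amax; rewrite hc c0 rmorph0 mul0r eqxx.
Qed.

(** * Index, length and integrality *)

Fixpoint weighted_sum (a : seq nat) (w : seq R) : R :=
  if a is k :: a' then k%:R * head 0 w + weighted_sum a' (behead w) else 0.

(* The index of F at the point xi, for the weights w, is at least t. *)
Fixpoint index_ge (m : nat) (w xi : seq R) {struct m} : mvpoly m -> R -> Prop :=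
  match m return mvpoly m -> R -> Prop with
  | 0 => fun F t => F = 0 \/ t <= 0
  | m'.+1 => fun F t => forall k,
      index_ge (behead w) (behead xi) (F^`N(k)).[cst m' (head 0 xi)]
        (t - k%:R * head 0 w)
  end.

Fixpoint l1norm (m : nat) : mvpoly m -> R :=
  match m return mvpoly m -> R with
  | 0 => fun F => `|F : R|
  | m'.+1 => fun F => \sum_(i < size (F : {poly _})) l1norm (F : {poly mvpoly m'})`_i
  end.

Fixpoint integral_coefs (m : nat) : mvpoly m -> Prop :=
  match m return mvpoly m -> Prop with
  | 0 => fun F => (F : R) \is a Num.int
  | m'.+1 => fun F => forall i, integral_coefs (F : {poly mvpoly m'})`_i
  end.

(** The multiplier c is kept apart from d because a determinant of order l multiplies all degrees by
    l. *)
Fixpoint degree_le (m c : nat) (d : seq nat) {struct m} : mvpoly m -> Prop :=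
  match m return mvpoly m -> Prop with
  | 0 => fun=> True
  | m'.+1 => fun F => (size (F : {poly mvpoly m'}) <= (c * head 0%N d).+1)%N /\
      forall i, degree_le c (behead d) (F : {poly mvpoly m'})`_i
  end.

Lemma nderivnM (A : comNzRingType) (p q : {poly A}) k :
  (p * q)^`N(k) = \sum_(i < k.+1) p^`N(i) * q^`N(k - i).
Proof.
elim/poly_ind: p k => [|p c IH] k.
  rewrite mul0r raddf0 big1 // => i _.
  by rewrite raddf0 mul0r.
have -> : (p * 'X + c%:P) * q = (p * q) * 'X + c *: q.
  by rewrite mulrDl mul_polyC mulrAC.
case: k => [|k]; first by rewrite big_ord1 !nderivn0 mulrDl mul_polyC mulrAC.
rewrite nderivnD nderivnZ big_ord_recl nderivn0 subn0.
have -> : (p * q * 'X)^`N(k.+1) = (p * q)^`N(k) + (p * q)^`N(k.+1) * 'X.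
  by have := nderivnMXaddC k (p * q) 0; rewrite addr0.
rewrite !IH [X in _ + X * 'X]big_ord_recl nderivn0 subn0 /=.
under [X in _ = _ + X]eq_bigr => i _.
  rewrite /bump /= add1n subSS nderivnMXaddC mulrDl.
  over.
rewrite big_split /= mulrDl [in X in _ = X]mulrDl mul_polyC mulr_suml.
have -> : \sum_(i < k.+1) p^`N(bump 0 i) * q^`N(k.+1 - bump 0 i) * 'X =
  \sum_(i < k.+1) p^`N(i.+1) * 'X * q^`N(k - i).
  by apply: eq_bigr => i _; rewrite /bump /= add1n subSS mulrAC.
ring.
Qed.

Lemma horner_map_hasse m a (G : {poly mvpoly m}) x :
  (map_poly (hasse m a) G).[cst m x] = hasse m a G.[cst m x].
Proof.
have h : (size (map_poly (hasse m a) G) <= size G)%N.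
  by apply/leq_sizeP => j hj; rewrite coef_map nth_default ?raddf0.
rewrite (horner_coef_wide _ h) horner_coef raddf_sum; apply: eq_bigr => i _.
by rewrite coef_map -rmorphXn mulrC [in RHS]mulrC /= hasse_cstM.
Qed.

Lemma nderivn_comp (A : comNzRingType) (F : {poly A}) a k :
  F^`N(a)^`N(k) = F^`N(a + k) *+ 'C(a + k, a).
Proof.
apply/polyP => i; rewrite coefMn !coef_nderivn -!mulrnA addnA; congr (_ *+ _).
apply/eqP; rewrite -(@eqn_pmul2r (a`! * k`! * i`!)) ?muln_gt0 ?fact_gt0 //.
apply/eqP.
have h1 := bin_fact (leq_addr (k + i) a); rewrite addKn in h1.
have h2 := bin_fact (leq_addr i k); rewrite addKn in h2.
have h3 := bin_fact (leq_addr i (a + k)); rewrite addKn in h3.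
have h4 := bin_fact (leq_addr k a); rewrite addKn in h4.
rewrite -addnA in h3 *.
transitivity ((a + (k + i))`!).
  by rewrite -h1 -h2; ring.
by rewrite -h3 -h4; ring.
Qed.

Lemma nderivn_map_add (A B : nzRingType) (f : {additive A -> B}) (p : {poly A}) k :
  (map_poly f p)^`N(k) = map_poly f (p^`N(k)).
Proof. by apply/polyP => i; rewrite coef_nderivn !coef_map coef_nderivn raddfMn. Qed.

Lemma index_ge_le m (w xi : seq R) (F : mvpoly m) s t : t <= s -> index_ge w xi F s -> index_ge w xi F t.
Proof.
elim: m w xi F s t => [|m IH] w xi F s t h /=.
  by case=> [->|h2]; [left|right; exact: le_trans h2].
by move=> H k; apply: IH (H k); rewrite lerB.
Qed.

Lemma all_ge0_head (w : seq R) : all (>= 0) w -> 0 <= head 0 w /\ all (>= 0) (behead w).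
Proof. by case: w => [|x w] //= /andP[]. Qed.

Lemma index_ge_neg m (w xi : seq R) (F : mvpoly m) t : all (>= 0) w -> t <= 0 -> index_ge w xi F t.
Proof.
elim: m w xi F t => [|m IH] w xi F t /= hw ht; first by right.
move=> k; have [h1 h2] := all_ge0_head hw; apply: IH => //.
by rewrite subr_le0 (le_trans ht) // mulr_ge0.
Qed.

Lemma index_ge0 m (w xi : seq R) t : index_ge w xi (0 : mvpoly m) t.
Proof.
elim: m w xi t => [|m IH] w xi t /=; first by left.
by move=> k; rewrite raddf0 horner0.
Qed.

Lemma index_geD m (w xi : seq R) (F G : mvpoly m) t :
  index_ge w xi F t -> index_ge w xi G t -> index_ge w xi (F + G) t.
Proof.
elim: m w xi F G t => [|m IH] w xi F G t /=.
  by case=> [->|?]; [rewrite add0r|right].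
by move=> hF hG k; rewrite nderivnD hornerD; apply: IH; [exact: hF|exact: hG].
Qed.

Lemma index_ge_sum m (w xi : seq R) (I : finType) (F : I -> mvpoly m) t :
  (forall i, index_ge w xi (F i) t) -> index_ge w xi (\sum_i F i) t.
Proof.
move=> h; elim/big_ind: _ => //; first exact: index_ge0.
by move=> x y; exact: index_geD.
Qed.

Lemma index_geM m (w xi : seq R) (F G : mvpoly m) s t :
  index_ge w xi F s -> index_ge w xi G t -> index_ge w xi (F * G) (s + t).
Proof.
elim: m w xi F G s t => [|m IH] w xi F G s t /=.
  case=> [->|hs]; first by rewrite mul0r; left.
  case=> [->|ht]; first by rewrite mulr0; left.
  by right; rewrite -[leRHS](addr0 0) lerD.
move=> hF hG k; rewrite nderivnM horner_sum; apply: index_ge_sum => i.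
rewrite hornerM; apply: index_ge_le (IH _ _ _ _ _ _ (hF i) (hG (k - i)%N)).
rewrite natrB; last by rewrite -ltnS ltn_ord.
by rewrite le_eqVlt; apply/orP; left; apply/eqP; ring.
Qed.

Lemma index_ge_prod m (w xi : seq R) l (F : 'I_l -> mvpoly m) (t : 'I_l -> R) : all (>= 0) w ->
  (forall i, index_ge w xi (F i) (t i)) -> index_ge w xi (\prod_i F i) (\sum_i t i).
Proof.
move=> hw; elim: l F t => [|l IH] F t h.
  by rewrite !big_ord0; exact: index_ge_neg.
by rewrite !big_ord_recl; apply: index_geM => //; exact: IH.
Qed.

Lemma index_ge_det m (w xi : seq R) l (M : 'M[mvpoly m]_l) (t : 'I_l -> R) : all (>= 0) w ->
  (forall i j, index_ge w xi (M i j) (t i)) -> index_ge w xi (\det M) (\sum_i t i).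
Proof.
move=> hw h; rewrite /determinant; apply: index_ge_sum => s.
rewrite -[X in index_ge _ _ _ X]add0r; apply: index_geM; first exact: index_ge_neg.
exact: index_ge_prod.
Qed.

Lemma weighted_sum_cons a (w : seq R) : weighted_sum a w = (head 0%N a)%:R * head 0 w + weighted_sum (behead a) (behead w).
Proof. by case: a => //=; rewrite mul0r add0r. Qed.

Lemma weighted_sum_ge0 a (w : seq R) : all (>= 0) w -> 0 <= weighted_sum a w.
Proof.
elim: a w => //= k a IH w hw; have [h1 h2] := all_ge0_head hw.
by rewrite addr_ge0 ?IH // mulr_ge0.
Qed.

Lemma index_ge_hasse m (w xi : seq R) a (F : mvpoly m) t : all (>= 0) w ->
  index_ge w xi F t -> index_ge w xi (hasse m a F) (t - weighted_sum a w).
Proof.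
elim: m w xi a F t => [|m IH] w xi a F t hw.
  move=> /= [->|h]; [by left|right].
  by rewrite subr_le0 (le_trans h) // weighted_sum_ge0.
move=> H k; rewrite hasseS nderivn_map_add horner_map_hasse.
rewrite nderivn_comp hornerMn raddfMn /=.
have [h1 h2] := all_ge0_head hw.
have := IH _ _ (behead a) _ _ h2 (H (head 0%N a + k)%N).
rewrite -/index_ge => H1.
rewrite -[hasse _ _ _ *+ _]mulr_natl.
have := index_geM (index_ge_neg (behead xi) ('C(head 0%N a + k, head 0%N a)%:R : mvpoly m) h2 (lexx 0)) H1.
apply: index_ge_le; rewrite (weighted_sum_cons a w) natrD.
by rewrite le_eqVlt; apply/orP; left; apply/eqP; ring.
Qed.

Lemma l1norm0 m : l1norm (0 : mvpoly m) = 0.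
Proof. by case: m => [|m] /=; rewrite ?normr0 // size_poly0 big_ord0. Qed.

Lemma l1norm_ge0 m (F : mvpoly m) : 0 <= l1norm F.
Proof. by elim: m F => [|m IH] F //=; apply: sumr_ge0 => i _. Qed.

Lemma l1norm_wide m (F : mvpoly m.+1) n : (size (F : {poly _}) <= n)%N ->
  l1norm F = \sum_(i < n) l1norm (F : {poly mvpoly m})`_i.
Proof.
move=> h; rewrite /= (big_ord_widen n (fun i => l1norm (F : {poly mvpoly m})`_i)) //.
rewrite [RHS](bigID (fun i : 'I_n => (i < size (F : {poly _}))%N)) /=.
rewrite [X in _ = _ + X]big1 ?addr0 // => i; rewrite -leqNgt => hi.
by rewrite nth_default // l1norm0.
Qed.

Lemma l1norm_coef m (F : mvpoly m.+1) i : l1norm (F : {poly mvpoly m})`_i <= l1norm F.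
Proof.
rewrite (@l1norm_wide m F (maxn i.+1 (size (F : {poly _})))) ?leq_maxr //.
have h : (i < maxn i.+1 (size (F : {poly mvpoly m})))%N by rewrite leq_maxl.
by rewrite (bigD1 (Ordinal h)) //= lerDl sumr_ge0 // => j _; exact: l1norm_ge0.
Qed.

Lemma l1normD m (F G : mvpoly m) : l1norm (F + G) <= l1norm F + l1norm G.
Proof.
elim: m F G => [|m IH] F G; first exact: ler_normD.
pose n := maxn (size (F : {poly _})) (size (G : {poly _})).
rewrite (@l1norm_wide m F n) ?leq_maxl // (@l1norm_wide m G n) ?leq_maxr //.
rewrite (@l1norm_wide m (F + G) n) ?size_polyD // -big_split /=.
by apply: ler_sum => i _; rewrite coefD.
Qed.

Lemma l1norm_sum m (I : Type) (r : seq I) (P : pred I) (F : I -> mvpoly m) :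
  l1norm (\sum_(i <- r | P i) F i) <= \sum_(i <- r | P i) l1norm (F i).
Proof.
elim/big_ind2: _ => [|x a y b h1 h2|//]; first by rewrite l1norm0.
by apply: le_trans (l1normD _ _) _; exact: lerD.
Qed.

Lemma l1normM m (F G : mvpoly m) : l1norm (F * G) <= l1norm F * l1norm G.
Proof.
elim: m F G => [|m IH] F G; first by rewrite /= normrM.
pose f := map_poly (@l1norm m) F; pose g := map_poly (@l1norm m) G.
have cf i : f`_i = l1norm (F : {poly mvpoly m})`_i by rewrite coef_map_id0 // l1norm0.
have cg i : g`_i = l1norm (G : {poly mvpoly m})`_i by rewrite coef_map_id0 // l1norm0.
(* The length is the value at 1 of the polynomial formed by the lengths of the coefficients, so
   products reduce to evaluation of a real polynomial. *)
have hs (P : mvpoly m.+1) : l1norm P = (map_poly (@l1norm m) (P : {poly mvpoly m})).[1].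
  have h : (size (map_poly (@l1norm m) (P : {poly mvpoly m})) <= size (P : {poly mvpoly m}))%N.
    by apply/leq_sizeP => j hj; rewrite coef_map_id0 ?l1norm0 // nth_default ?l1norm0.
  rewrite (horner_coef_wide _ h) /=; apply: eq_bigr => i _.
  by rewrite expr1n mulr1 coef_map_id0 ?l1norm0.
rewrite (hs F) (hs G) -/f -/g -hornerM.
pose n := maxn (size (f * g)) (size (F * G : {poly mvpoly m})).
rewrite (@horner_coef_wide _ n) ?leq_maxl // (@l1norm_wide m _ n) ?leq_maxr //.
apply: ler_sum => i _; rewrite expr1n mulr1 !coefM.
apply: le_trans (l1norm_sum _ _ _) _; apply: ler_sum => j _.
by rewrite cf cg.
Qed.

Lemma l1normMn m (F : mvpoly m) n : l1norm (F *+ n) = l1norm F *+ n.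
Proof.
elim: m F n => [|m IH] F n; first by rewrite /= normrMn.
rewrite (@l1norm_wide m (F *+ n) (size (F : {poly _}))); last first.
  by apply/leq_sizeP => j hj; rewrite coefMn nth_default ?mul0rn.
by rewrite /= -sumrMnl; apply: eq_bigr => i _; rewrite coefMn IH.
Qed.

Lemma l1norm_cst m c : l1norm (cst m c) = `|c|.
Proof.
elim: m c => [|m IH] c //; rewrite (@l1norm_wide m _ 1) ?size_polyC_leq1 //.
by rewrite big_ord1 cstS coefC eqxx.
Qed.

Lemma l1norm_sign m (b : nat) : l1norm ((-1) ^+ b : mvpoly m) = 1.
Proof.
have -> : (-1) ^+ b = cst m ((-1) ^+ b) by rewrite rmorphXn rmorphN1.
by rewrite l1norm_cst normrX normrN1 expr1n.
Qed.

Lemma l1norm_prod m l (F : 'I_l -> mvpoly m) (K : R) :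
  (forall i, l1norm (F i) <= K) -> l1norm (\prod_i F i) <= K ^+ l.
Proof.
elim: l F => [|l IH] F h; first by rewrite big_ord0 -(rmorph1 (cst m)) l1norm_cst normr1.
rewrite big_ord_recl exprS; apply: le_trans (l1normM _ _) _.
by apply: ler_pM; rewrite ?l1norm_ge0 ?IH.
Qed.

Lemma l1norm_det m l (M : 'M[mvpoly m]_l) (K : R) :
  (forall i j, l1norm (M i j) <= K) -> l1norm (\det M) <= (l`!%N)%:R * K ^+ l.
Proof.
move=> h; apply: le_trans (l1norm_sum _ _ _) _.
have -> : (l`!%N)%:R * K ^+ l = \sum_(s : 'S_l) K ^+ l.
  by rewrite sumr_const card_Sn mulr_natl.
apply: ler_sum => s _; apply: le_trans (l1normM _ _) _; rewrite l1norm_sign mul1r.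
by apply: l1norm_prod.
Qed.

Lemma integral_coefs0 m : integral_coefs (0 : mvpoly m).
Proof. by elim: m => [|m IH] /=; rewrite ?rpred0 // => i; rewrite coef0. Qed.

Lemma integral_coefsD m (F G : mvpoly m) : integral_coefs F -> integral_coefs G -> integral_coefs (F + G).
Proof.
elim: m F G => [|m IH] F G /=; first exact: rpredD.
by move=> h1 h2 i; rewrite coefD; apply: IH.
Qed.

Lemma integral_coefs_sum m (I : Type) (r : seq I) (P : pred I) (F : I -> mvpoly m) :
  (forall i, P i -> integral_coefs (F i)) -> integral_coefs (\sum_(i <- r | P i) F i).
Proof.
move=> h; elim/big_ind: _ => //; first exact: integral_coefs0.
by move=> x y; exact: integral_coefsD.
Qed.

Lemma integral_coefsM m (F G : mvpoly m) : integral_coefs F -> integral_coefs G -> integral_coefs (F * G).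
Proof.
elim: m F G => [|m IH] F G /=; first exact: rpredM.
by move=> h1 h2 i; rewrite coefM; apply: integral_coefs_sum => j _; apply: IH.
Qed.

Lemma integral_coefs_cst m c : c \is a Num.int -> integral_coefs (cst m c).
Proof.
elim: m => [|m IH] //= h i; rewrite coefC; case: eqP => _; first exact: IH.
exact: integral_coefs0.
Qed.

Lemma integral_coefs_prod m (I : finType) (F : I -> mvpoly m) :
  (forall i, integral_coefs (F i)) -> integral_coefs (\prod_i F i).
Proof.
move=> h; elim/big_ind: _ => //; last by move=> x y; exact: integral_coefsM.
by rewrite -(rmorph1 (cst m)); apply: integral_coefs_cst; rewrite rpred1.
Qed.

Lemma integral_coefs_det m l (M : 'M[mvpoly m]_l) : (forall i j, integral_coefs (M i j)) -> integral_coefs (\det M).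
Proof.
move=> h; apply: integral_coefs_sum => s _; apply: integral_coefsM; last exact: integral_coefs_prod.
have -> : (-1) ^+ s = cst m ((-1) ^+ s) by rewrite rmorphXn rmorphN1.
by apply: integral_coefs_cst; rewrite rpredX // rpredN rpred1.
Qed.

Lemma integral_coefsMn m (F : mvpoly m) n : integral_coefs F -> integral_coefs (F *+ n).
Proof.
by move=> h; rewrite -mulr_natl -(rmorph_nat (cst m)); apply: integral_coefsM => //;
  apply: integral_coefs_cst; rewrite rpred_nat.
Qed.

Lemma integral_coefs_hasse m a (F : mvpoly m) : integral_coefs F -> integral_coefs (hasse m a F).
Proof.
elim: m a F => [|m IH] a F // h i.
by rewrite coef_hasseS; apply: IH; apply: integral_coefsMn; exact: h.
Qed.

Lemma integral_coefs_l1norm_ge1 m (F : mvpoly m) : integral_coefs F -> F != 0 -> 1 <= l1norm F.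
Proof.
elim: m F => [|m IH] F; first by move=> /= h; exact: norm_intr_ge1.
move=> h F0; apply: le_trans (l1norm_coef F (size (F : {poly mvpoly m})).-1).
apply: IH; first exact: h.
by have := F0; rewrite -lead_coef_eq0.
Qed.

Lemma degree_le0 m c d : degree_le c d (0 : mvpoly m).
Proof.
elim: m d => [|m IH] d //=; rewrite size_poly0; split=> // i.
by rewrite coef0.
Qed.

Lemma degree_leD m c d (F G : mvpoly m) : degree_le c d F -> degree_le c d G -> degree_le c d (F + G).
Proof.
elim: m d F G => [|m IH] d F G //= [h1 h2] [h3 h4]; split.
  by apply: leq_trans (size_polyD _ _) _; rewrite geq_max h1.
by move=> i; rewrite coefD; apply: IH.
Qed.

Lemma degree_le_sum m c d (I : Type) (r : seq I) (P : pred I) (F : I -> mvpoly m) :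
  (forall i, P i -> degree_le c d (F i)) -> degree_le c d (\sum_(i <- r | P i) F i).
Proof.
move=> h; elim/big_ind: _ => //; first exact: degree_le0.
by move=> x y; exact: degree_leD.
Qed.

Lemma degree_leM m c c' d (F G : mvpoly m) :
  degree_le c d F -> degree_le c' d G -> degree_le (c + c') d (F * G).
Proof.
elim: m d F G => [|m IH] d F G //= [h1 h2] [h3 h4]; split; last first.
  by move=> i; rewrite coefM; apply: degree_le_sum => j _; apply: IH.
apply: leq_trans (size_polyMleq _ _) _; rewrite mulnDl.
have aux (s t a b : nat) : (s <= a.+1 -> t <= b.+1 -> (s + t).-1 <= (a + b).+1)%N by lia.
exact: aux.
Qed.

Lemma degree_le_cst m d c x : degree_le c d (cst m x).
Proof.
elim: m d => [|m IH] d //=; split.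
  by apply: leq_trans (size_polyC_leq1 _) _.
by move=> i; rewrite coefC; case: eqP => _ //; exact: degree_le0.
Qed.

Lemma degree_le_prod m d l (F : 'I_l -> mvpoly m) :
  (forall i, degree_le 1 d (F i)) -> degree_le l d (\prod_i F i).
Proof.
elim: l F => [|l IH] F h; first by rewrite big_ord0 -(rmorph1 (cst m)); exact: degree_le_cst.
by rewrite big_ord_recl; apply: (degree_leM (c := 1)) => //; exact: IH.
Qed.

Lemma degree_le_det m d l (M : 'M[mvpoly m]_l) :
  (forall i j, degree_le 1 d (M i j)) -> degree_le l d (\det M).
Proof.
move=> h; apply: degree_le_sum => s _; apply: (degree_leM (c := 0)); last exact: degree_le_prod.
have -> : (-1) ^+ s = cst m ((-1) ^+ s) by rewrite rmorphXn rmorphN1.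
exact: degree_le_cst.
Qed.

Lemma degree_le_map m c d (F : mvpoly m) : degree_le c d F -> degree_le 1 (map (muln c) d) F.
Proof.
elim: m d F => [|m IH] d F //= [h1 h2]; rewrite mul1n; split.
  by case: d h1 h2 => //=; rewrite muln0.
by move=> i; rewrite behead_map; apply: IH.
Qed.

Lemma degree_leMn m c d (F : mvpoly m) n : degree_le c d F -> degree_le c d (F *+ n).
Proof.
move=> h; rewrite -mulr_natl -(rmorph_nat (cst m)).
by apply: (degree_leM (c := 0)) => //; exact: degree_le_cst.
Qed.

Lemma degree_le_hasse m c d a (F : mvpoly m) : degree_le c d F -> degree_le c d (hasse m a F).
Proof.
elim: m d a F => [|m IH] d a F // [h1 h2]; split; last first.
  by move=> i; rewrite coef_hasseS; apply: IH; apply: degree_leMn; exact: h2.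
apply/leq_sizeP => j hj; rewrite coef_hasseS nth_default ?mul0rn ?raddf0 //.
by apply: leq_trans h1 (leq_trans hj _); rewrite leq_addl.
Qed.

Lemma bin_le_exp2 n k : ('C(n, k) <= 2 ^ n)%N.
Proof.
have [h|h] := leqP k n; last by rewrite bin_small.
have := Pascal 1 1 n; rewrite addn1 => ->.
have hk : (k < n.+1)%N by rewrite ltnS.
by rewrite (bigD1 (Ordinal hk)) //= !exp1n !muln1 leq_addr.
Qed.

Lemma l1norm_hasse m d a (F : mvpoly m) : degree_le 1 d F -> l1norm (hasse m a F) <= 2 ^+ sumn d * l1norm F.
Proof.
elim: m d a F => [|m IH] d a F.
  by move=> _; rewrite ler_peMl ?normr_ge0 // exprn_ege1 // ler1n.
move=> hF; have [h1 h2] := hF; rewrite mul1n in h1.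
set k := head 0%N a; pose n := (head 0%N d).+1.
have hd : (size (hasse m.+1 a F : {poly mvpoly m}) <= n)%N.
  by have [+ _] := degree_le_hasse a hF; rewrite mul1n.
rewrite (l1norm_wide hd).
have -> : 2 ^+ sumn d = 2 ^+ sumn (behead d) * 2 ^+ head 0%N d :> R.
  by rewrite -exprD; congr (_ ^+ _); case: (d) => //= x s; rewrite addnC.
rewrite -mulrA; apply: (@le_trans _ _
   (2 ^+ sumn (behead d) * (\sum_(i < n) 2 ^+ head 0%N d * l1norm (F : {poly mvpoly m})`_(k + i)))).
  rewrite mulr_sumr; apply: ler_sum => i _; rewrite coef_hasseS.
  apply: le_trans (IH (behead d) _ _ _) _; first by apply: degree_leMn; exact: h2.
  rewrite ler_pM2l ?exprn_gt0 ?ltr0n // l1normMn -[l1norm _ *+ _]mulr_natl.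
  have [hk|hk] := ltnP (k + i) (size (F : {poly mvpoly m})); last first.
    by rewrite nth_default // l1norm0 !mulr0.
  rewrite ler_wpM2r ?l1norm_ge0 // -natrX ler_nat.
  apply: leq_trans (_ : 2 ^ (k + i) <= _)%N.
    exact: bin_le_exp2.
  by rewrite leq_exp2l // -ltnS; exact: leq_trans hk h1.
rewrite ler_pM2l ?exprn_gt0 ?ltr0n // -mulr_sumr ler_pM2l ?exprn_gt0 ?ltr0n //.
rewrite (@l1norm_wide m F (k + n)%N) ?(leq_trans h1) ?leq_addl //.
rewrite big_split_ord /= lerDr sumr_ge0 // => i _; exact: l1norm_ge0.
Qed.

(* Provided by the extraction of one non-zero coefficient of U. *)
Lemma coef_functional m (U : mvpoly m) : U != 0 -> exists chi : {additive mvpoly m -> R},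
  [/\ forall a v, chi (a * cst m v) = chi a * v,
      forall a, integral_coefs a -> chi a \is a Num.int,
      forall a, `|chi a| <= l1norm a & chi U != 0].
Proof.
elim: m U => [|m IH] U U0.
  by exists (idfun : {additive mvpoly 0 -> R}); split.
have [|chi [h1 h2 h3 h4]] := IH (lead_coef (U : {poly mvpoly m})); first by rewrite lead_coef_eq0.
exists (chi \o coefp (size (U : {poly mvpoly m})).-1 : {additive mvpoly m.+1 -> R}).
split=> [a v|a ha|a|] //=; first by rewrite coefMC h1.
  by apply: h2; exact: ha.
by apply: le_trans (h3 _) _; exact: (l1norm_coef a).
Qed.

(** * Roth's lemma *)

Lemma coprime_int (x y n : nat) (r : R) : (0 < y)%N -> coprime x y ->
  x%:R ^+ n * r \is a Num.int -> y%:R * r \is a Num.int -> r \is a Num.int.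
Proof.
move=> y0 cxy h1 h2.
have [a b E _] := egcdnP (x ^ n) y0.
have /eqP c1 : coprime y (x ^ n) by rewrite coprimeXr // coprime_sym.
rewrite c1 in E.
have -> : r = a%:R * (y%:R * r) - b%:R * (x%:R ^+ n * r).
  by rewrite !mulrA -natrX -!natrM E natrD -mulrBl addrAC subrr add0r mul1r.
by rewrite rpredB // rpredM // rpred_nat.
Qed.

(** Gauss's lemma for the primitive divisor y X - x. Solving for the quotient from the constant term
    upwards introduces only powers of x as denominators, from the top downwards only a factor y; by
    coprimality there are none. *)
Lemma divide_linear (V : {poly R}) (x y : nat) : (0 < y)%N -> coprime x y ->
  (forall i, V`_i \is a Num.int) -> V.[x%:R / y%:R] = 0 ->
  exists2 V2 : {poly R}, forall i, V2`_i \is a Num.int &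
    V = y%:R *: (V2 * 'X) - x%:R *: V2.
Proof.
move=> y0 cxy hV /eqP/factor_theorem [q Vq].
have y0' : y%:R != 0 :> R by rewrite pnatr_eq0 -lt0n.
pose r : {poly R} := y%:R^-1 *: q.
have VE : V = y%:R *: (r * 'X) - x%:R *: r.
  rewrite Vq mulrBr /r -scalerAl !scalerA divff // scale1r; congr (_ - _).
  by rewrite mulrC mul_polyC.
clearbody r.
have V0 : V`_0 = - (x%:R * r`_0) by rewrite {1}VE coefB !coefZ coefMX /= mulr0 sub0r.
have VS i : V`_i.+1 = y%:R * r`_i - x%:R * r`_i.+1.
  by rewrite {1}VE coefB !coefZ coefMX.
have up i : x%:R ^+ i.+1 * r`_i \is a Num.int.
  elim: i => [|i IH]; first by rewrite expr1 -rpredN -V0.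
  have -> : x%:R ^+ i.+2 * r`_i.+1 = y%:R * (x%:R ^+ i.+1 * r`_i) - x%:R ^+ i.+1 * V`_i.+1.
    by rewrite VS exprS; ring.
  by rewrite rpredB // rpredM // ?rpredX // rpred_nat.
have down n i : (size r <= i + n)%N -> r`_i \is a Num.int.
  elim: n i => [|n IH] i hi; first by rewrite nth_default ?rpred0 // -[i]addn0.
  apply: coprime_int y0 cxy (up i) _.
  have -> : y%:R * r`_i = V`_i.+1 + x%:R * r`_i.+1 by rewrite VS subrK.
  by rewrite rpredD // rpredM ?rpred_nat // IH // addSnnS.
by exists r => // i; apply: (down (size r)); rewrite leq_addl.
Qed.

(** V is divisible by (y X - x)^k over the integers, so its lowest non-zero coefficient is divisible
    by x^k. The lowest one is chosen because x is the larger entry; the leading one is a multiple of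
    y^k only, and y may be 1. *)
Lemma low_coef (V : {poly R}) (x y k : nat) : (0 < x)%N -> (0 < y)%N -> coprime x y ->
  V != 0 -> (forall i, V`_i \is a Num.int) ->
  (forall i, (i < k)%N -> V^`N(i).[x%:R / y%:R] = 0) ->
  exists j, [/\ forall i, (i < j)%N -> V`_i = 0, V`_j != 0 &
     exists2 z : R, z \is a Num.int & V`_j = x%:R ^+ k * z].
Proof.
move=> x0 y0 cxy; elim: k V => [|k IH] V V0 hV hk.
  have hex : exists j, V`_j != 0 by exists (size V).-1; rewrite -/(lead_coef V) lead_coef_eq0.
  case: (ex_minnP hex) => j hj hmin; exists j; split=> //.
    by move=> i; apply: contraTeq => h; rewrite -leqNgt hmin.
  by exists V`_j => //; rewrite expr0 mul1r.
have [|V2 hV2 VE] := divide_linear y0 cxy hV; first by have := hk 0%N isT; rewrite nderivn0.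
have y0' : y%:R != 0 :> R by rewrite pnatr_eq0 -lt0n.
have V20 : V2 != 0 by apply: contraNneq V0 => h; rewrite VE h mul0r !scaler0 subr0.
have [|j [h1 h2 [z zi hz]]] := IH V2 V20 hV2.
  move=> i hi; have := hk i.+1 hi.
  rewrite VE raddfB /= !nderivnZ.
  have -> : (V2 * 'X)^`N(i.+1) = V2^`N(i) + V2^`N(i.+1) * 'X.
    by have := nderivnMXaddC i V2 0; rewrite addr0.
  rewrite hornerD hornerN !hornerZ hornerD hornerMX mulrDr.
  have -> : y%:R * (V2^`N(i.+1).[x%:R / y%:R] * (x%:R / y%:R)) = x%:R * V2^`N(i.+1).[x%:R / y%:R].
    by field.
  by rewrite addrK => /eqP; rewrite mulf_eq0 (negPf y0') => /eqP.
have x0' : x%:R != 0 :> R by rewrite pnatr_eq0 -lt0n.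
exists j; split.
- case=> [|i] hi; rewrite VE coefB !coefZ coefMX /= (h1 _ hi) !mulr0 ?subrr //.
  by rewrite (h1 _ (ltnW hi)) mulr0 subrr.
- rewrite VE coefB !coefZ coefMX; case: j {hz} h1 h2 => [|j] h1 h2 /=; last rewrite (h1 j) //;
  by rewrite mulr0 sub0r oppr_eq0 mulf_neq0.
- exists (- z); first by rewrite rpredN.
  rewrite VE coefB !coefZ coefMX; case: j h1 h2 hz => [|j] h1 h2 hz /=; last rewrite (h1 j) //;
  by rewrite mulr0 sub0r hz exprS; ring.
Qed.

Lemma vanishing_order_bound (V : {poly R}) (x y k : nat) (K : R) :
  (0 < x)%N -> (0 < y)%N -> coprime x y ->
  V != 0 -> (forall i, V`_i \is a Num.int) -> (forall i, `|V`_i| <= K) ->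
  (forall i, (i < k)%N -> V^`N(i).[x%:R / y%:R] = 0) -> x%:R ^+ k <= K.
Proof.
move=> x0 y0 cxy V0 hV hK hk.
have [j [_ h2 [z zi hz]]] := low_coef x0 y0 cxy V0 hV hk.
apply: le_trans (hK j); rewrite hz normrM normrX normr_nat ler_peMr ?exprn_ge0 //.
apply: norm_intr_ge1 => //; apply: contraNneq h2 => h.
by rewrite hz h mulr0.
Qed.

(** * Splitting off the outermost variable *)

Definition tensor_sum m l (f : 'I_l -> mvpoly m) (g : 'I_l -> {poly R}) : mvpoly m.+1 :=
  \sum_a (f a)%:P * map_poly (cst m) (g a).

(** In a decomposition with the fewest terms both families are free, since a linear dependence in
    either would absorb one term into the others. The expansion in powers of the outer variable
    bounds the number of terms. *)
Lemma tensor_rank m (F : mvpoly m.+1) : exists l (f : 'I_l -> mvpoly m) (g : 'I_l -> mvpoly 1),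
  [/\ (l <= size (F : {poly mvpoly m}))%N, free_family f, free_family g & F = tensor_sum f g].
Proof.
pose Q l := exists (f : 'I_l -> mvpoly m) (g : 'I_l -> {poly R}), F = tensor_sum f g.
have Qsz : Q (size (F : {poly mvpoly m})).
  exists (fun i : 'I_(size (F : {poly mvpoly m})) => (F : {poly mvpoly m})`_i), (fun i => 'X^i).
  rewrite /tensor_sum -[LHS]coefK poly_def; apply: eq_bigr => i _.
  by rewrite map_polyXn mul_polyC.
have exQ : exists l, `[< Q l >] by exists (size (F : {poly mvpoly m})); apply/asboolP.
case: (ex_minnP exQ) => l /asboolP [f [g FE]] lmin.
have lsz : (l <= size (F : {poly mvpoly m}))%N by apply: lmin; apply/asboolP.
exists l, f, g; split=> //.
- move=> c hc b; apply/eqP; apply: contraT => cb.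
  case: l f g FE lmin lsz c hc b cb => [|l] f g FE lmin lsz c hc b cb; first by case: b cb.
  have: (l.+1 <= l)%N; last by rewrite ltnn.
  apply: lmin; apply/asboolP.
  exists (fun k => f (lift b k)), (fun k => g (lift b k) - (c (lift b k) / c b) *: g b).
  move: hc; rewrite (bigD1_ord b) //= => /(canRL (addrK _)); rewrite sub0r => hc.
  have fb : f b = - \sum_(k < l) cst m (c (lift b k) / c b) * f (lift b k).
    apply: (@mulfI _ (cst m (c b))); first by rewrite fmorph_eq0.
    rewrite hc mulrN; congr (- _); rewrite mulr_sumr; apply: eq_bigr => k _.
    by rewrite mulrA -rmorphM mulrCA divff // mulr1.
  rewrite FE /tensor_sum (bigD1_ord b) //= fb.
  rewrite rmorphN rmorph_sum mulNr mulr_suml -sumrN -big_split; apply: eq_bigr => k _ /=.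
  rewrite rmorphB /= map_polyZ /= -mul_polyC polyCM.
  ring.
- move=> c hc b; apply/eqP; apply: contraT => cb.
  case: l f g FE lmin lsz c hc b cb => [|l] f g FE lmin lsz c hc b cb; first by case: b cb.
  have: (l.+1 <= l)%N; last by rewrite ltnn.
  apply: lmin; apply/asboolP.
  exists (fun k => f (lift b k) - cst m (c (lift b k) / c b) * f b), (fun k => g (lift b k)).
  move: hc; rewrite (bigD1_ord b) //= => /(canRL (addrK _)); rewrite sub0r => hc.
  have gb : g b = - \sum_(k < l) (c (lift b k) / c b) *: g (lift b k).
    apply: (@mulfI _ (c b)%:P); first by rewrite polyC_eq0.
    rewrite hc mulrN; congr (- _); rewrite mulr_sumr; apply: eq_bigr => k _.
    by rewrite -mul_polyC mulrA -polyCM mulrCA divff // mulr1.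
  rewrite FE /tensor_sum (bigD1_ord b) //= gb.
  rewrite rmorphN rmorph_sum mulrN mulr_sumr -sumrN -big_split; apply: eq_bigr => k _ /=.
  rewrite rmorphB /= map_polyZ /= -mul_polyC polyCM.
  ring.
Qed.

Lemma hasse_tensor m a k (f : mvpoly m) (g : {poly R}) :
  hasse m.+1 (k :: a) (f%:P * map_poly (cst m) g) =
  (hasse m a f)%:P * map_poly (cst m) (g^`N(k)).
Proof.
apply/polyP => i; rewrite coef_hasseS /= !coefCM !coef_map /= coef_nderivn.
by rewrite -mulrnAr -rmorphMn /= mulrC hasse_cstM mulrC.
Qed.

(** With F = sum_c f_c g_c, the matrix of mixed derivatives is the product of the matrix of
    derivatives of the g_c and the transpose of that of the f_c. Its determinant therefore factors
    into the two generalized Wronskians. *)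
Lemma wronskian_split m (F : mvpoly m.+1) : F != 0 ->
  exists l (a : 'I_l -> seq nat) (k : 'I_l -> nat) (U : mvpoly m) (V : {poly R}),
  [/\ (0 < l <= size (F : {poly mvpoly m}))%N,
      forall i, (sumn (a i) <= i)%N /\ (k i <= i)%N, U != 0, V != 0 &
      \det (\matrix_(i, j) hasse m.+1 (k i :: a j) F) = U%:P * map_poly (cst m) V].
Proof.
move=> F0; have [l [f [g [lsz frf frg FE]]]] := tensor_rank F.
have [a [ha U0]] := generalized_wronskian frf.
have [b [hb V0]] := generalized_wronskian frg.
exists l, a, (fun i => head 0%N (b i)), (\det (\matrix_(i, j) hasse m (a i) (f j))),
  (\det (\matrix_(i, j) ((g j : {poly R})^`N(head 0%N (b i))))); split=> //.
- rewrite lsz andbT lt0n; apply: contraNneq F0 => l0.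
  rewrite FE /tensor_sum big1 // => i _; have := ltn_ord i; rewrite {2}l0.
  by [].
- move=> i; split=> //; apply: leq_trans (hb i); case: (b i) => //= x s.
  exact: leq_addr.
- move: V0; congr (\det _ != 0); apply/matrixP => i j; rewrite !mxE.
  by rewrite hasseS map_poly_id.
rewrite -(det_tr (\matrix_(i, j) hasse m (a i) (f j))) -!det_map_mx mulrC -det_mulmx.
congr (\det _); apply/matrixP => i j; rewrite !mxE FE raddf_sum; apply: eq_bigr => c _.
by rewrite !mxE hasse_tensor mulrC.
Qed.

(** The first [minn l n.+1] terms, with n the integer part of d e / 4, are at least e / 4 each, and
    their number is at least l e / 8 because l <= 2 d. *)
Lemma sum_truncated_ge (e : R) (l d : nat) : 0 < e <= 1 -> (0 < d)%N -> (l <= d.+1)%N ->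
  l%:R * e ^+ 2 / 32 <= \sum_(b < l) Num.max 0 (e / 2 - b%:R / d%:R).
Proof.
move=> /andP[e0 e1] d0 ld.
have d0' : 0 < d%:R :> R by rewrite ltr0n.
have x0 : 0 <= d%:R * e / 4 by apply: divr_ge0 => //; apply: mulr_ge0 => //; exact: ltW.
have /andP[n1 n2] := truncn_itv x0; set n := Num.truncn _ in n1 n2.
pose k := minn l n.+1.
apply: (@le_trans _ _ (k%:R * (e / 4))); last first.
  have kl : (k <= l)%N by exact: geq_minl.
  apply: (@le_trans _ _ (\sum_(b < l | (b < k)%N) (e / 4))).
    by rewrite -(big_ord_widen l (fun=> e / 4) kl) sumr_const card_ord mulr_natl.
  rewrite [leRHS](bigID (fun b : 'I_l => (b < k)%N)) /= -[leLHS]addr0; apply: lerD.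
    apply: ler_sum => b hb; rewrite le_max; apply/orP; right.
    have hbn : b%:R <= n%:R :> R.
      by rewrite ler_nat -ltnS; apply: leq_trans hb _; exact: geq_minr.
    have : b%:R / d%:R <= e / 4.
      rewrite ler_pdivrMr //; apply: le_trans hbn (le_trans n1 _).
      by rewrite le_eqVlt; apply/orP; left; apply/eqP; ring.
    lra.
  by apply: sumr_ge0 => b _; rewrite le_max lexx.
have : l%:R * e / 8 <= k%:R.
  rewrite /k; case: leqP => h.
    have : l%:R * e <= l%:R * 1 by rewrite ler_wpM2l.
    have : 0 <= l%:R :> R by [].
    lra.
  have : l%:R <= d%:R + 1 :> R by rewrite natr1 ler_nat.
  have : 1 <= d%:R :> R by rewrite ler1n.
  move=> h1 h2.
  have h3 : l%:R * e <= (2 * d%:R) * e by rewrite ler_wpM2r //; lra.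
  lra.
move=> h; have := ler_wpM2r (ltW e0) h.
rewrite expr2; lra.
Qed.

Lemma weighted_sum_le (a : seq nat) (w : seq R) (u : R) : 0 <= u -> all (fun v => v <= u) w ->
  weighted_sum a w <= (sumn a)%:R * u.
Proof.
move=> u0; elim: a w => [|k a IH] w hw /=; first by rewrite mul0r.
have [h1 h2] : head 0 w <= u /\ all (fun v => v <= u) (behead w).
  by case: w hw => [|v w] //= /andP[].
by rewrite natrD mulrDl lerD ?IH // ler_wpM2l.
Qed.

Lemma index_ge_scale m (w xi : seq R) (F : mvpoly m) t c : 0 < c ->
  index_ge w xi F t -> index_ge (map ( *%R c) w) xi F (c * t).
Proof.
move=> c0; elim: m w xi F t => [|m IH] w xi F t /=.
  by case=> [->|h]; [left|right; rewrite pmulr_rle0].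
move=> H k; have := IH _ _ _ _ (H k); rewrite behead_map; apply: index_ge_le.
rewrite mulrBr; have -> : head 0 [seq c * i | i <- w] = c * head 0 w.
  by case: (w) => //=; rewrite mulr0.
by rewrite mulrCA.
Qed.

Lemma index_ge_cstM m (w xi : seq R) (U : mvpoly m) r t : all (>= 0) w -> r != 0 ->
  index_ge w xi (U * cst m r) t -> index_ge w xi U t.
Proof.
move=> hw r0 h.
have := index_geM h (index_ge_neg xi (cst m r^-1) hw (lexx 0)).
by rewrite -mulrA -rmorphM divff // rmorph1 mulr1 addr0.
Qed.

Definition weights (d : seq nat) : seq R := [seq k%:R^-1 | k <- d].
Definition points (P : seq (nat * nat)) : seq R := [seq p.1%:R / p.2%:R | p <- P].

Lemma weights_ge0 d : all (>= 0) (weights d).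
Proof. by apply/allP => _ /mapP[k _ ->]; rewrite invr_ge0. Qed.

(** One number B bounds both the degrees and, in Roth's lemma, the logarithm of the length. The
    degrees grow by factors T along the list, and the heights x_j^d_j are at least e^(T B), far
    above every coefficient. *)
Definition roth_config (T B : R) (d : seq nat) (P : seq (nat * nat)) : bool :=
  [&& all (fun k => 0 < k)%N d,
      all (fun p => (0 < p.2 < p.1)%N && coprime p.1 p.2) P,
      pairwise (fun a b : nat => T * a%:R <= b%:R) d,
      all (fun k : nat => k%:R <= B) d &
      all2 (fun (k : nat) (p : nat * nat) => T * B <= k%:R * ln p.1%:R) d P].

(** Passing from F to a factor of its Wronskian of order l multiplies the degrees by l and B by l c,
    so only a factor c of T is lost, independently of l. *)
Lemma roth_config_scale T B T' B' c l (d : seq nat) P : (0 < l)%N ->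
  0 <= B -> 1 <= c -> c * T' <= T -> 1 <= T' -> B' = l%:R * c * B ->
  roth_config T B d P -> roth_config T' B' (map (muln l) d) P.
Proof.
move=> l0 B0 c1 cT T1 -> /and5P[h1 h2 h3 h4 h5].
have l0' : 0 <= l%:R :> R by [].
have TT : T' <= T.
  apply: le_trans cT; rewrite ler_peMl //; lra.
apply/and5P; split=> //.
- by rewrite all_map; apply: sub_all h1 => k /= hk; rewrite muln_gt0 l0.
- rewrite pairwise_map; apply: sub_pairwise h3 => a b /= hab.
  rewrite !natrM mulrCA ler_wpM2l //; apply: le_trans hab.
  by rewrite ler_wpM2r.
- rewrite all_map; apply: sub_all h4 => k /= hk.
  rewrite natrM -mulrA ler_wpM2l //; apply: le_trans hk _.
  by rewrite ler_peMl.
- elim: d P h5 {h1 h2 h3 h4} => [|k d IH] [|p P] //= /andP[h5 h6]; rewrite IH // andbT.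
  rewrite natrM -!mulrA mulrCA ler_wpM2l //; apply: le_trans h5.
  by rewrite mulrA ler_wpM2r // mulrC.
Qed.

Lemma factorial_le_expR l (B : R) : l%:R <= B -> (l`!)%:R <= expR B ^+ l.
Proof.
move=> hl.
suff H n : (n <= l)%N -> (n`!)%:R <= expR B ^+ n by exact: H.
elim: n => [|n IH] hn; first by rewrite expr0.
rewrite factS natrM exprS ler_pM ?IH ?(ltnW hn) //.
apply: (@le_trans _ _ l%:R); first by rewrite ler_nat.
apply: le_trans hl (le_trans _ (expR_ge1Dx _)); lra.
Qed.

Lemma exp2_le_expR n : 2 ^+ n <= expR n%:R :> R.
Proof.
rewrite -[n%:R]mulr1 expRM_natl; apply: lerXn2r; rewrite ?nnegrE ?expR_ge0 //.
have := @expR_ge1Dx R 1; lra.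
Qed.

Lemma sumn_le (d : seq nat) (B : R) : all (fun k : nat => k%:R <= B) d ->
  (sumn d)%:R <= (size d)%:R * B.
Proof.
elim: d => [|k d IH] /=; first by rewrite mul0r.
by move=> /andP[h1 h2]; rewrite natrD -nat1r mulrDl mul1r lerD ?IH.
Qed.

(** Only the product of U and V is known to be integral. The functional of [coef_functional] turns
    it into a scalar multiple of V with integral coefficients bounded by the length, to which
    [vanishing_order_bound] applies. *)
Lemma nonvanishing_derivative m (U : mvpoly m) (V : {poly R}) (B : R) (x y : nat) :
  (0 < y < x)%N -> coprime x y -> U != 0 -> V != 0 ->
  integral_coefs (U%:P * map_poly (cst m) V : mvpoly m.+1) ->
  l1norm (U%:P * map_poly (cst m) V : mvpoly m.+1) <= expR B ->
  exists2 k : nat, k%:R * ln x%:R <= B & V^`N(k).[x%:R / y%:R] != 0.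
Proof.
move=> /andP[y0 yx] cxy U0 V0 WI WL.
have [chi [h1 h2 h3 h4]] := coef_functional U0.
have cE i : chi (U%:P * map_poly (cst m) V)`_i = chi U * V`_i.
  by rewrite coefCM coef_map h1.
have x1 : 1 < x%:R :> R by rewrite ltr1n; exact: leq_ltn_trans yx.
have lx : 0 < ln x%:R :> R by exact: ln_gt0.
apply: contrapT => H.
have B0 : 0 <= B.
  rewrite -ler_expR expR0; apply: le_trans WL; apply: integral_coefs_l1norm_ge1 => //.
  by rewrite mulf_neq0 ?polyC_eq0 // map_poly_eq0.
have /andP[n1 n2] := truncn_itv (divr_ge0 B0 (ltW lx)); set n := Num.truncn _ in n1 n2.
have : x%:R ^+ n.+1 <= expR B :> R.
  apply: (vanishing_order_bound (V := chi U *: V) (x := x) (y := y)) => //.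
  - exact: ltn_trans yx.
  - by rewrite scaler_eq0 negb_or h4.
  - by move=> i; rewrite coefZ -cE; apply: h2; exact: (WI i).
  - move=> i; rewrite coefZ -cE; apply: le_trans (h3 _) (le_trans _ WL).
    exact: l1norm_coef.
  move=> i hi; rewrite nderivnZ hornerZ; apply/eqP; rewrite mulf_eq0; apply/orP; right.
  apply: contraT => hV; case: H; exists i => //.
  rewrite -ler_pdivlMr //; apply: le_trans n1; rewrite ler_nat; exact: hi.
have xp : (x%:R ^+ n.+1 : R) \is Num.pos by rewrite posrE exprn_gt0 // (lt_trans _ x1).
rewrite -[x%:R ^+ _]lnK // ler_expR lnXn ?(lt_trans _ x1) // -[ln _ *+ _]mulr_natl.
by rewrite leNgt -ltr_pdivrMr // n2.
Qed.

(** Each entry has length at most e^((m + 1) B), the m B coming from the binomial factors; the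
    factorial of l adds at most e^(2 B) per row. *)
Lemma roth_step_bound m l (d : seq nat) (F : mvpoly m) (a : 'I_l -> 'I_l -> seq nat) (B : R) :
  size d = m -> l%:R <= 2 * B -> 0 <= B ->
  all (fun k : nat => k%:R <= B) d -> degree_le 1 d F -> l1norm F <= expR B ->
  l1norm (\det (\matrix_(i, j) hasse m (a i j) F)) <= expR (l%:R * (m%:R + 3) * B).
Proof.
move=> sd lB B0 dB Fd FL.
have /l1norm_det h : forall i j, l1norm ((\matrix_(i, j) hasse m (a i j) F) i j) <= expR ((m%:R + 1) * B).
  move=> i j; rewrite mxE; apply: le_trans (l1norm_hasse _ Fd) _.
  rewrite mulrDl mul1r expRD ler_pM ?exprn_ge0 ?l1norm_ge0 //.
  have h2 : 2 ^+ sumn d <= expR (sumn d)%:R :> R by exact: exp2_le_expR.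
  by apply: le_trans h2 _; rewrite ler_expR -sd; exact: sumn_le.
apply: le_trans h _; rewrite -mulrA expRM_natl.
have -> : (m%:R + 3) * B = 2 * B + (m%:R + 1) * B by ring.
rewrite expRD exprMn ler_wpM2r ?exprn_ge0 ?expR_ge0 //.
exact: factorial_le_expR.
Qed.

(* Roth's lemma. The Wronskian W = U V of F inherits the index of F; the index of
   U is bounded by induction, and the order of vanishing of V by Gauss's lemma. *)
Lemma roth m (e : R) : 0 < e -> exists T, 1 <= T /\
  forall (d : seq nat) (P : seq (nat * nat)) (B : R) (F : mvpoly m),
    size d = m -> 1 <= B -> roth_config T B d P ->
    F != 0 -> integral_coefs F -> degree_le 1 d F -> l1norm F <= expR B ->
    ~ index_ge (weights d) (points P) F e.
Proof.
elim: m e => [|m IH] e e0.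
  exists 1; split=> // d P B F _ _ _ F0 _ _ _ /= [h|h]; first by rewrite h eqxx in F0.
  by rewrite ltNge h in e0.
pose e1 := Num.min e 1.
have e10 : 0 < e1 by rewrite lt_min e0 ltr01.
have e11 : e1 <= 1 by rewrite ge_min lexx orbT.
have e1e : e1 <= e by rewrite ge_min lexx.
(* The index of the Wronskian W is at least l e1^2 / 32 = 2 l e'; one half is compared with U, the
   other with V. *)
pose e' := e1 ^+ 2 / 64.
have e'0 : 0 < e' by rewrite divr_gt0 // exprn_gt0.
have [T' [T1 hT']] := IH e' e'0.
pose c : R := m%:R + 4.
have c4 : 4 <= c by rewrite lerDr.
(* Here c comes from [roth_step_bound] in m + 1 variables. The three parts of T serve the induction
   hypothesis for U, the order of vanishing of V, and the cost of differentiating in the inner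
   variables. *)
pose T := c * (T' + e'^-1) + 2 / e1.
have e'i : 0 < e'^-1 by rewrite invr_gt0.
have cT0 : 0 <= c * T' by rewrite mulr_ge0; lra.
have ce0 : 0 <= c * e'^-1 by rewrite mulr_ge0; lra.
have e1i : 0 < 2 / e1 by rewrite divr_gt0.
have TE : T = c * T' + c * e'^-1 + 2 / e1 by rewrite /T; ring.
have hT1 : c * T' <= T by rewrite TE; lra.
have hT2 : c <= T * e'.
  have : c * e'^-1 <= T by rewrite TE; lra.
  by rewrite ler_pdivrMr.
have hT3 : 2 <= T * e1.
  have : 2 / e1 <= T by rewrite TE; lra.
  by rewrite ler_pdivrMr.
have T1' : 1 <= T.
  apply: (le_trans T1 (le_trans _ hT1)).
  by rewrite ler_peMl //; lra.
exists T; split=> //.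
move=> [|d0 ds] // [|[x y] ps] B F [sd] B1 cfg F0 FI Fd FL /(index_ge_le e1e) FIdx.
  by move: cfg; rewrite /roth_config /= !andbF.
have /and5P[/= /andP[d0_gt0 dsp] /andP[/andP[yx cxy] psp] /andP[hsep dss] /andP[d0B dsB]
  /andP[hx hps]] := cfg.
have B0 : 0 <= B by lra.
have [l [a [k [U [V [/andP[l0 lsz] hak U0 V0 WE]]]]]] := wronskian_split F0.
have ld : (l <= d0.+1)%N.
  by have [h _] := Fd; rewrite mul1n in h; exact: leq_trans lsz h.
have ld' : l%:R <= d0%:R + 1 :> R by rewrite natr1 ler_nat.
have l0' : 0 < l%:R :> R by rewrite ltr0n.
have lB : l%:R <= 2 * B by lra.
pose W : mvpoly m.+1 := \det (\matrix_(i, j) hasse m.+1 (k i :: a j) F).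
have WI : integral_coefs W by apply: integral_coefs_det => i j; rewrite mxE; exact: integral_coefs_hasse.
have Wd : degree_le l (d0 :: ds) W by apply: degree_le_det => i j; rewrite mxE; exact: degree_le_hasse.
pose B' := l%:R * c * B.
have WL : l1norm W <= expR B'.
  have := @roth_step_bound m.+1 l (d0 :: ds) F (fun i j => k i :: a j) B.
  rewrite /= sd => /(_ erefl lB B0); rewrite d0B dsB => /(_ isT Fd FL).
  by have -> : l%:R * (m.+1%:R + 3) * B = B' by rewrite /B' /c -natr1; ring.
have B'1 : 1 <= B'.
  have h1 : 1 <= l%:R :> R by rewrite ler1n.
  have h2 : 1 <= c by lra.
  by rewrite -[leLHS]mul1r ler_pM // -[leLHS]mul1r ler_pM.
have cfg' : roth_config T' B' (map (muln l) ds) ps.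
  apply: (roth_config_scale (T := T) (B := B) (c := c)) => //; first by lra.
  by apply/and5P.
(* U need not have integral coefficients, but its multiple by the leading coefficient of V is a
   coefficient of W. *)
pose U' := (W : {poly mvpoly m})`_(size V).-1.
have U'E : U' = U * cst m (lead_coef V).
  by rewrite /U' /W WE coefCM coef_map.
have U'0 : U' != 0.
  by rewrite U'E mulf_neq0 // fmorph_eq0 lead_coef_eq0.
have notU t : index_ge (weights ds) (points ps) U t -> t < l%:R * e'.
  move=> ht; rewrite ltNge; apply/negP => hle.
  apply: (hT' (map (muln l) ds) ps B' U') => //.
  - by rewrite size_map; exact: sd.
  - exact: (WI (size V).-1).
  - by apply: degree_le_map; case: Wd => _; exact.
  - by apply: le_trans WL; exact: l1norm_coef.
  have w0 : all (>= 0) (weights (map (muln l) ds)) by exact: weights_ge0.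
  have li0 : 0 < l%:R^-1 :> R by rewrite invr_gt0.
  have := index_ge_scale li0 (index_ge_le hle ht).
  rewrite mulKf ?gt_eqF //.
  have -> : [seq l%:R^-1 * i | i <- weights ds] = weights [seq (l * i)%N | i <- ds].
    by rewrite /weights -!map_comp; apply: eq_map => i /=; rewrite natrM invfM.
  move=> h; have := index_geM h (index_ge_neg (points ps) (cst m (lead_coef V)) w0 (lexx 0)).
  by rewrite addr0 U'E.
rewrite /W WE in WI WL.
have [k0 hk0 Vk0] := nonvanishing_derivative yx cxy U0 V0 WI WL.
have lx : 0 < ln x%:R :> R.
  apply: ln_gt0; rewrite ltr1n; case/andP: yx; exact: leq_ltn_trans.
have d0' : 0 < d0%:R :> R by rewrite ltr0n.
have k0e : k0%:R / d0%:R <= l%:R * e'.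
  rewrite ler_pdivrMr // -(ler_pM2r lx); apply: le_trans hk0 _.
  have h1 : T * B * (l%:R * e') <= d0%:R * ln x%:R * (l%:R * e').
    by rewrite ler_wpM2r // mulr_ge0 // ltW.
  have h2 : B' <= T * B * (l%:R * e').
    rewrite /B' -mulrA [leRHS](_ : _ = l%:R * ((T * e') * B)); last by ring.
    by rewrite ler_wpM2l // ler_wpM2r.
  apply: le_trans h2 (le_trans h1 _).
  by rewrite le_eqVlt; apply/orP; left; apply/eqP; ring.
(* In row i the outer derivative costs at most i / d0 and the inner ones at most e1 / 2. The
   truncation is allowed since an index is never negative. *)
pose t (i : 'I_l) : R := Num.max 0 (e1 / 2 - i%:R / d0%:R).
have Widx : index_ge (weights (d0 :: ds)) (points ((x, y) :: ps)) W (\sum_i t i).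
  have hw : all (>= 0) (weights (d0 :: ds)) by exact: weights_ge0.
  apply: index_ge_det => // i j; rewrite mxE /t maxEle; case: ifP => _; last exact: index_ge_neg.
  apply: index_ge_le (index_ge_hasse _ hw FIdx) => /=.
  have [_ hi2] := hak i.
  have Td0 : 0 < T * d0%:R by rewrite mulr_gt0 //; lra.
  (* This is where the outermost variable must have the least degree: inner derivatives of total
     order at most d0 are divided by degrees of at least T d0. *)
  have hdot : weighted_sum (a j) (weights ds) <= (sumn (a j))%:R * (T * d0%:R)^-1.
    apply: weighted_sum_le; first by rewrite invr_ge0 ltW.
    apply/allP => _ /mapP[b hb ->]; have hb1 := allP hsep _ hb.
    by rewrite lef_pV2 ?posrE // (lt_le_trans Td0).
  have hsum : (sumn (a j))%:R <= d0%:R :> R.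
    rewrite ler_nat; apply: leq_trans (hak j).1 _.
    by rewrite -ltnS; exact: leq_trans (ltn_ord j) ld.
  have h3 : (sumn (a j))%:R * (T * d0%:R)^-1 <= e1 / 2.
    rewrite ler_pdivrMr //; apply: le_trans hsum _.
    have : 2 * d0%:R <= (T * e1) * d0%:R by rewrite ler_wpM2r // ltW.
    lra.
  have h4 : (k i)%:R * d0%:R^-1 <= i%:R / d0%:R :> R.
    by rewrite ler_wpM2r ?ler_nat // invr_ge0 ltW.
  lra.
have tge : l%:R * e1 ^+ 2 / 32 <= \sum_i t i.
  by apply: sum_truncated_ge => //; rewrite e10.
(* The derivative of order k0 does not annihilate V at the point, so U inherits the index of W less
   k0 / d0. That is at least 2 l e' - l e', against [notU]. *)
have := Widx k0.
have -> : (W : {poly mvpoly m})^`N(k0).[cst m (head 0 (points ((x, y) :: ps)))] =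
    U * cst m V^`N(k0).[x%:R / y%:R].
  by rewrite /W WE mul_polyC nderivnZ hornerZ nderivn_map horner_map.
have hw' : all (>= 0) (weights ds) by exact: weights_ge0.
move=> /(index_ge_cstM hw' Vk0)/notU /=.
move: tge; have -> : l%:R * e1 ^+ 2 / 32 = 2 * (l%:R * e') :> R by rewrite /e'; field.
rewrite [k0%:R * _](_ : _ = k0%:R / d0%:R) //; lra.
Qed.

(** * The auxiliary polynomial *)

Fixpoint box (d : seq nat) : seq (seq nat) :=
  if d is k :: d' then [seq i :: s | i <- iota 0 k.+1, s <- box d'] else [:: [::]].

Lemma big_box (V : nmodType) (k : nat) d (f : seq nat -> V) :
  \sum_(i <- box (k :: d)) f i = \sum_(a < k.+1) \sum_(i <- box d) f (nat_of_ord a :: i).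
Proof.
rewrite [LHS](@big_allpairs_dep _ _ _ _ _ _ _ (iota 0 k.+1) (fun=> box d)).
have -> : iota 0 k.+1 = index_iota 0 k.+1 by rewrite /index_iota subn0.
by rewrite big_mkord.
Qed.

Lemma mem_box_cons k d a s : (a :: s \in box (k :: d)) = (a <= k)%N && (s \in box d).
Proof.
apply/allpairsP/andP => [[[u v] [/= h1 h2 [-> ->]]]|[h1 h2]].
  by move: h1; rewrite (mem_iota 0 k.+1) ltnS.
by exists (a, s); split=> //; rewrite (mem_iota 0 k.+1) ltnS.
Qed.

Lemma mem_box_cons_nil k d : ([::] \in box (k :: d)) = false.
Proof. by apply/negP => /allpairsP[[u v] []]. Qed.

Lemma box_uniq d : uniq (box d).
Proof.
elim: d => // k d IH; apply: (allpairs_uniq (f := cons) (s := iota 0 k.+1) (iota_uniq _ _) IH).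
by move=> [a s] [b t] _ _ /= [-> ->].
Qed.

Lemma size_mem_box d s : s \in box d -> size s = size d.
Proof.
elim: d s => [|k d IH] [|a s] //; first by rewrite mem_box_cons_nil.
by rewrite mem_box_cons => /andP[_ /IH /= ->].
Qed.

Lemma size_box_cons k d : size (box (k :: d)) = (k.+1 * size (box d))%N.
Proof. by rewrite [LHS](size_allpairs cons (iota 0 k.+1) (box d)) size_iota. Qed.

Lemma size_box_gt0 d : (0 < size (box d))%N.
Proof. by elim: d => // k d IH; rewrite size_box_cons muln_gt0. Qed.

Lemma size_box_le d : (size (box d) <= 2 ^ sumn d)%N.
Proof.
elim: d => // k d IH; rewrite size_box_cons /= expnD leq_mul //.
exact: ltn_expl.
Qed.

Lemma sum_centered k : (0 < k)%N ->
  \sum_(a < k.+1) ((nat_of_ord a)%:R / k%:R - 2^-1) = 0 :> R.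
Proof.
move=> k0; have k0' : k%:R != 0 :> R by rewrite pnatr_eq0 -lt0n.
have h n : 2 * (\sum_(a < n.+1) (nat_of_ord a)%:R) = n%:R * (n%:R + 1) :> R.
  elim: n => [|n IH]; first by rewrite big_ord1 mulr0 mul0r.
  by rewrite big_ord_recr /= mulrDr IH -natr1; ring.
rewrite sumrB -mulr_suml sumr_const card_ord -[2^-1 *+ _]mulr_natl -natr1.
have -> : \sum_(a < k.+1) (nat_of_ord a)%:R = k%:R * (k%:R + 1) / 2 :> R.
  by rewrite -h; field.
by field.
Qed.

Lemma sum_const_seq (T : Type) (s : seq T) (x : R) : \sum_(i <- s) x = (size s)%:R * x.
Proof.
elim: s => [|a s IH]; first by rewrite big_nil mul0r.
by rewrite big_cons IH /= -nat1r mulrDl mul1r.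
Qed.

Lemma weighted_sum_centered_cons k d a i :
  weighted_sum (a :: i) (weights (k :: d)) - (size (k :: d))%:R / 2 =
  (a%:R / k%:R - 2^-1) + (weighted_sum i (weights d) - (size d)%:R / 2).
Proof. rewrite /= -natr1; lra. Qed.

Lemma box_first_moment d : all (fun k => 0 < k)%N d ->
  \sum_(i <- box d) (weighted_sum i (weights d) - (size d)%:R / 2) = 0.
Proof.
elim: d => [|k d IH]; first by rewrite big_seq1 mul0r subr0.
move=> /andP[k0 hd]; rewrite big_box.
under eq_bigr => a _.
  under eq_bigr do rewrite weighted_sum_centered_cons.
  rewrite big_split /= (IH hd) addr0 sum_const_seq.
  over.
by rewrite -mulr_sumr sum_centered // mulr0.
Qed.

(* The coordinates of a uniform point of the box are independent with variance at
   most 1/4 each. *)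
Lemma box_second_moment d : all (fun k => 0 < k)%N d ->
  \sum_(i <- box d) (weighted_sum i (weights d) - (size d)%:R / 2) ^+ 2 <=
  (size (box d))%:R * (size d)%:R / 4.
Proof.
elim: d => [|k d IH].
  by rewrite big_seq1 mul0r subr0 expr0n mulr0 mul0r.
move=> /andP[k0 hd]; rewrite big_box.
pose u (a : nat) : R := a%:R / k%:R - 2^-1.
have sq (p q : R) : (p + q) ^+ 2 = p ^+ 2 + (p * 2) * q + q ^+ 2 by ring.
under eq_bigr => a _.
  under eq_bigr do rewrite weighted_sum_centered_cons -/(u a) sq.
  rewrite !big_split /= -[X in _ + X + _]mulr_sumr (box_first_moment hd) mulr0 addr0 sum_const_seq.
  over.
rewrite big_split /= sumr_const card_ord.
have -> : (size (box (k :: d)))%:R * (size (k :: d))%:R / 4 =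
    (k.+1)%:R * ((size (box d))%:R * 4^-1) + (k.+1)%:R * ((size (box d))%:R * (size d)%:R / 4) :> R.
  by rewrite size_box_cons natrM /= -[(size d).+1%:R]natr1; field.
apply: lerD; last first.
  by rewrite -[leLHS]mulr_natl ler_wpM2l // IH.
rewrite -mulr_sumr mulrCA ler_wpM2l //.
rewrite mulr_natl -[X in _ *+ X](card_ord k.+1) -sumr_const; apply: ler_sum => a _.
have k0' : 0 < k%:R :> R by rewrite ltr0n.
have h1 : 0 <= (nat_of_ord a)%:R / k%:R :> R by rewrite divr_ge0.
have h2 : (nat_of_ord a)%:R / k%:R <= 1 :> R.
  by rewrite ler_pdivrMr // mul1r ler_nat -ltnS.
rewrite /u expr2; nra.
Qed.

(** Pigeonhole: with X = M a, unknowns from 0 to X give values from 0 to X^2 in each equation, and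
    (X^2 + 1)^L < (X + 1)^(2 L) <= (X + 1)^M for L > 0. *)
Lemma siegel (M L a : nat) (A : 'I_L -> 'I_M -> nat) :
  (forall l i, (A l i <= a)%N) -> (2 * L <= M)%N -> (0 < M)%N -> (0 < a)%N ->
  exists c : 'I_M -> int, [/\ exists i, c i != 0, forall i, (`|c i| <= M * a)%N &
    forall l, \sum_i (A l i)%:Z * c i = 0].
Proof.
move=> hA LM M0 a0; pose X := (M * a)%N.
have X0 : (0 < X)%N by rewrite muln_gt0 M0.
pose v (u : {ffun 'I_M -> 'I_X.+1}) l := (\sum_i A l i * u i)%N.
have hv u l : (v u l < (X ^ 2).+1)%N.
  rewrite ltnS; apply: leq_trans (_ : (\sum_(i < M) a * X <= _)%N).
    by apply: leq_sum => i _; apply: leq_mul => //; rewrite -ltnS ltn_ord.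
  by rewrite sum_nat_const card_ord mulnA.
pose f u := [ffun l => Ordinal (hv u l)].
have X1 z : (0 < z)%N -> ((z ^ 2).+1 < z.+1 ^ 2)%N.
  by rewrite -!mulnn mulSn mulnS => h; lia.
have : ~~ injectiveb f.
  apply/negP => /injectiveP/leq_card; rewrite !card_ffun !card_ord leqNgt => /negP; apply.
  have [->|L0] := posnP L; first by rewrite expn0 -{1}(exp1n M) ltn_exp2r.
  apply: (@leq_trans ((X.+1 ^ 2) ^ L)%N); last by rewrite -expnM leq_exp2l.
  by rewrite ltn_exp2r // X1.
move=> /injectivePn [u1 [u2 u12 /ffunP fu]].
exists (fun i => (u1 i : nat)%:Z - (u2 i : nat)%:Z); split.
- apply: contrapT => H; move/eqP: u12; apply; apply/ffunP => i; apply/val_inj.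
  have /eqP : ((u1 i : nat)%:Z - (u2 i : nat)%:Z == 0).
    by apply: contraT => h; case: H; exists i.
  by move/subr0_eq => [].
- by move=> i; have := ltn_ord (u1 i); have := ltn_ord (u2 i); rewrite -/X; lia.
move=> l; have := congr1 val (fu l); rewrite !ffunE /= /v => h.
under eq_bigr do rewrite mulrBr.
rewrite sumrB; apply/eqP; rewrite subr_eq0; apply/eqP.
have hz (u : {ffun 'I_M -> 'I_X.+1}) :
    \sum_i (A l i)%:Z * (u i : nat)%:Z = (\sum_i A l i * u i)%N%:Z.
  by rewrite (big_morph Posz PoszD (erefl _)); apply: eq_bigr => i _; rewrite PoszM.
by rewrite !hz h.
Qed.

(** The Taylor coefficient of order k of the monomial X^i at (1, ..., 1). *)
Fixpoint multi_bin (i k : seq nat) : nat :=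
  if i is a :: i' then ('C(a, head 0%N k) * multi_bin i' (behead k))%N else 1%N.

Lemma multi_bin_le d i k : i \in box d -> (multi_bin i k <= 2 ^ sumn d)%N.
Proof.
elim: d i k => [|n d IH] [|a i] k //; first by rewrite mem_box_cons_nil.
rewrite mem_box_cons => /andP[h1 h2] /=; rewrite expnD leq_mul ?IH //.
by apply: leq_trans (bin_le_exp2 _ _) _; rewrite leq_exp2l.
Qed.

Lemma count_markov (T : Type) (s : seq T) (P : pred T) (g : T -> R) (t : R) :
  (forall i, 0 <= g i) -> (forall i, P i -> t <= g i) ->
  (count P s)%:R * t <= \sum_(i <- s) g i.
Proof.
move=> g0 h; elim: s => [|a s IH]; first by rewrite mul0r big_nil.
rewrite big_cons /= natrD mulrDl lerD // .
by case: (boolP (P a)) => [/h|_] ; rewrite ?mul1r ?mul0r.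
Qed.

(** Chebyshev's inequality: the variance is at most m / 4 and (m ep)^2 >= m, so at most a quarter of
    the box lies off the centre. The unknowns are the central exponents, at least three quarters of
    the box; the equations belong to the lower tail, at most one quarter. This is the ratio that
    [siegel] asks for. *)
Lemma auxiliary_polynomial (ep : R) (d : seq nat) : all (fun k => 0 < k)%N d ->
  0 < ep -> 1 <= (size d)%:R * ep ^+ 2 ->
  let m : R := (size d)%:R in
  exists c : seq nat -> int,
  [/\ exists2 i, i \in box d & c i != 0,
      forall i, c i != 0 -> i \in box d /\ `|weighted_sum i (weights d) - m / 2| <= m * ep,
      forall i, (`|c i| <= size (box d) * 2 ^ sumn d)%N &
      forall k, k \in box d -> weighted_sum k (weights d) < m / 2 - m * ep ->
        \sum_(i <- box d) c i * (multi_bin i k)%:Z = 0].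
Proof.
move=> hd ep0 hm m.
pose g i : R := weighted_sum i (weights d) - m / 2.
pose ismid i := `|g i| <= m * ep.
pose mid := [seq i <- box d | ismid i].
pose low := [seq k <- box d | weighted_sum k (weights d) < m / 2 - m * ep].
pose N := size (box d).
have m0 : 0 < m.
  rewrite ltr0n lt0n; apply: contraTneq hm => ->; rewrite mul0r; lra.
have hbad : (4 * count (predC ismid) (box d) <= N)%N.
  rewrite -(ler_nat R) natrM -(ler_pM2r m0).
  have := count_markov (P := predC ismid) (g := fun i => g i ^+ 2) (t := m) (box d).
  move=> /(_ (fun i => sqr_ge0 _)) H.
  have {}H : (count (predC ismid) (box d))%:R * m <= \sum_(i <- box d) g i ^+ 2.
    apply: H => i /=; rewrite -ltNge => hi.
    rewrite -[g i ^+ 2]real_normK ?num_real //.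
    apply: (@le_trans _ _ ((m * ep) ^+ 2)); last first.
      by apply: lerXn2r; rewrite ?nnegrE ?mulr_ge0 ?normr_ge0 // ltW.
    by rewrite exprMn expr2 -mulrA ler_peMr // ltW.
  have := le_trans H (box_second_moment hd); rewrite -/N -/m; lra.
have hsz : (size mid + count (predC ismid) (box d))%N = N.
  by rewrite size_filter count_predC.
have hlow : (size low <= count (predC ismid) (box d))%N.
  rewrite size_filter; apply: sub_count => k /= hk; rewrite -ltNge.
  rewrite -normrN; apply: lt_le_trans (ler_norm _); rewrite /g; lra.
have N0 : (0 < N)%N by exact: size_box_gt0.
have [||||c [[i0 ci0] cb cz]] := siegel (a := (2 ^ sumn d)%N) (A := fun (l : 'I_(size low)) (i : 'I_(size mid)) =>
    multi_bin (nth [::] mid i) (nth [::] low l)).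
- move=> l i; apply: multi_bin_le; have := mem_nth [::] (ltn_ord i).
  by rewrite mem_filter => /andP[].
- by lia.
- by lia.
- by rewrite expn_gt0.
have umid : uniq mid by rewrite filter_uniq // box_uniq.
pose c' i : int := if insub (index i mid) is Some o then c o else 0.
have c'E (o : 'I_(size mid)) : c' (nth [::] mid o) = c o.
  by rewrite /c' index_uniq // valK.
have c'0 i : c' i != 0 -> i \in mid.
  by rewrite /c'; case: insubP => [u hu _ _|_]; [by rewrite -index_mem|by rewrite eqxx].
exists c'; split.
- exists (nth [::] mid i0); last by rewrite c'E.
  by have := mem_nth [::] (ltn_ord i0); rewrite mem_filter => /andP[].
- by move=> i /c'0; rewrite mem_filter => /andP[].
- move=> i; rewrite /c'; case: insubP => [u _ _|_]; last by rewrite absz0.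
  by apply: leq_trans (cb u) _; rewrite leq_mul2r; apply/orP; right; lia.
move=> k kd hk.
have kl : k \in low by rewrite mem_filter hk.
have kl' := kl; rewrite -index_mem in kl'.
have := cz (Ordinal kl'); rewrite /= nth_index // => E; rewrite -[RHS]E.
rewrite (bigID ismid) /= [X in _ + X]big1_seq ?addr0; last first.
  move=> i /andP[hi _]; have [->|/c'0] := eqVneq (c' i) 0; first by rewrite mul0r.
  by rewrite mem_filter (negPf hi).
rewrite -big_filter -/mid (big_nth [::]) big_mkord; apply: eq_bigr => o _.
by rewrite c'E mulrC.
Qed.

(** * Taylor coefficients, their homogenization and their size *)

Fixpoint poly_of_coefs (m : nat) (d : seq nat) (c : seq nat -> R) : mvpoly m :=
  match m return mvpoly m with
  | 0 => c [::]
  | m'.+1 => \poly_(k < (head 0%N d).+1) poly_of_coefs m' (behead d) (fun i => c (k :: i))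
  end.

Fixpoint taylor (m : nat) (xi : seq R) (k : seq nat) {struct m} : mvpoly m -> R :=
  match m return mvpoly m -> R with
  | 0 => fun F => F
  | m'.+1 => fun F => taylor (behead xi) (behead k) (F^`N(head 0%N k)).[cst m' (head 0 xi)]
  end.

Fixpoint taylor_monomial (xi : seq R) (i k : seq nat) : R :=
  if i is a :: i' then 'C(a, head 0%N k)%:R * head 0 xi ^+ (a - head 0%N k) *
    taylor_monomial (behead xi) i' (behead k) else 1.

Lemma integral_coefs_poly_of_coefs m d c : (forall i, c i \is a Num.int) -> integral_coefs (poly_of_coefs m d c).
Proof.
elim: m d c => [|m IH] d c h; first exact: h.
move=> i; rewrite coef_poly; case: ifP => _; last exact: integral_coefs0.
by apply: IH.
Qed.

Lemma degree_le_poly_of_coefs m d c : degree_le 1 d (poly_of_coefs m d c).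
Proof.
elim: m d c => [|m IH] d c //; split; first by rewrite mul1n; exact: size_poly.
by move=> i; rewrite coef_poly; case: ifP => _; [exact: IH|exact: degree_le0].
Qed.

Lemma l1norm_poly_of_coefs d c : l1norm (poly_of_coefs (size d) d c) <= \sum_(i <- box d) `|c i|.
Proof.
elim: d c => [|k d IH] c; first by rewrite big_seq1.
rewrite big_box (l1norm_wide (n := k.+1)); last exact: size_poly.
by apply: ler_sum => a _; rewrite coef_poly ltn_ord; exact: IH.
Qed.

Lemma poly_of_coefs_neq0 d c i : i \in box d -> c i != 0 -> poly_of_coefs (size d) d c != 0.
Proof.
elim: d c i => [|k d IH] c [|a i] //; first by rewrite mem_box_cons_nil.
rewrite mem_box_cons => /andP[ak hi] ci.
have := IH (fun i => c (a :: i)) i hi ci.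
apply: contraNneq => /(congr1 (fun F : {poly mvpoly (size d)} => F`_a)).
by rewrite coef0 coef_poly ltnS ak => h; apply/eqP; exact: h.
Qed.

Lemma taylor_sum m xi k (I : Type) (r : seq I) (F : I -> mvpoly m) :
  taylor xi k (\sum_(i <- r) F i) = \sum_(i <- r) taylor xi k (F i).
Proof.
elim: m xi k F => [|m IH] xi k F //=.
by rewrite raddf_sum horner_sum IH.
Qed.

Lemma taylor_cstM m xi k c (F : mvpoly m) : taylor xi k (cst m c * F) = c * taylor xi k F.
Proof.
elim: m xi k F => [|m IH] xi k F //=.
by rewrite mul_polyC nderivnZ hornerZ IH.
Qed.

Lemma taylor_poly_of_coefs d c xi k :
  taylor xi k (poly_of_coefs (size d) d c) = \sum_(i <- box d) c i * taylor_monomial xi i k.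
Proof.
elim: d c xi k => [|n d IH] c xi k; first by rewrite big_seq1 mulr1.
rewrite big_box /= poly_def raddf_sum horner_sum taylor_sum; apply: eq_bigr => a _ /=.
rewrite nderivnZ nderivnXn hornerZ hornerMn hornerXn -rmorphXn -rmorphMn /= [X in taylor _ _ X]mulrC taylor_cstM IH.
rewrite mulr_sumr; apply: eq_bigr => i _; rewrite -[_ ^+ _ *+ _]mulr_natl; ring.
Qed.

Lemma index_ge_taylor m (w xi : seq R) (F : mvpoly m) t : ~ index_ge w xi F t ->
  exists k, [/\ size k = m, weighted_sum k w < t & taylor xi k F != 0].
Proof.
elim: m w xi F t => [|m IH] w xi F t /=.
  move=> /not_orP [/eqP h1 /negP h2]; exists [::]; split=> //.
  by rewrite ltNge.
move=> /existsNP [k0 /IH [k [h1 h2 h3]]]; exists (k0 :: k); split=> //=.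
  by rewrite h1.
by rewrite -ltrBrDl.
Qed.

(* Homogenized monomial of a Taylor coefficient at the points x_j / y_j. *)
Fixpoint mono (P : seq (nat * nat)) (d i k : seq nat) : nat :=
  if P is p :: P' then
    ('C(head 0 i, head 0 k) * p.1 ^ (head 0 i - head 0 k) * p.2 ^ (head 0 d - head 0 i) *
     mono P' (behead d) (behead i) (behead k))%N
  else 1%N.

(** The denominator of the Taylor coefficient of order k; it is the same for all monomials, so one
    factor clears the whole sum. *)
Fixpoint ypow (P : seq (nat * nat)) (d k : seq nat) : nat :=
  if P is p :: P' then (p.2 ^ (head 0 d - head 0 k) * ypow P' (behead d) (behead k))%N
  else 1%N.

Lemma ypow_gt0 P d k : all (fun p => (0 < p.2 < p.1)%N) P -> (0 < ypow P d k)%N.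
Proof.
elim: P d k => [|p P IH] d k //= /andP[/andP[h _] hP].
by rewrite muln_gt0 expn_gt0 h IH.
Qed.

Lemma mono_taylor_monomial P d i k : all (fun p => (0 < p.2 < p.1)%N) P -> size P = size d ->
  i \in box d -> (mono P d i k)%:R = (ypow P d k)%:R * taylor_monomial (points P) i k :> R.
Proof.
elim: P d i k => [|p P IH] [|n d] // [|a i] k //; first by rewrite mulr1.
  by rewrite mem_box_cons_nil.
move=> /= /andP[/andP[y0 yx] hP] [sP]; rewrite mem_box_cons => /andP[an hi].
rewrite !natrM IH // !natrX.
have y0' : p.2%:R != 0 :> R by rewrite pnatr_eq0 -lt0n.
have [h|h] := leqP (head 0%N k) a; last by rewrite bin_small ?mul0r ?mulr0.
have -> : (n - head 0 k = (n - a) + (a - head 0 k))%N by lia.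
rewrite exprD exprMn exprVn.
have : p.2%:R ^+ (a - head 0 k)%N != 0 :> R by rewrite expf_neq0.
move=> h'; field.
by [].
Qed.

(** All x_j^d_j lie between e^D and e^D'. This converts exponents i_j into their weights i_j / d_j,
    uniformly in j. *)
Definition height_window (D D' : R) (d : seq nat) (P : seq (nat * nat)) : bool :=
  all2 (fun (n : nat) (p : nat * nat) => [&& (0 < n)%N, (0 < p.2 < p.1)%N,
    D <= n%:R * ln p.1%:R & n%:R * ln p.1%:R <= D']) d P.

Lemma height_window_size D D' d P : height_window D D' d P -> size P = size d.
Proof. by elim: d P => [|n d IH] [|p P] //= /andP[_ /IH ->]. Qed.

Lemma lognMr (q a b : nat) : (0 < a)%N -> (0 < b)%N ->
  (logn q (a * b))%:R * ln q%:R = (logn q a)%:R * ln q%:R + (logn q b)%:R * ln q%:R :> R.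
Proof. by move=> a0 b0; rewrite lognM // natrD mulrDl. Qed.

Lemma logn_ln_ge0 q a : 0 <= (logn q a)%:R * ln q%:R :> R.
Proof.
case: q => [|q]; first by rewrite ln0 // mulr0.
by rewrite mulr_ge0 // ln_ge0 // ler1n.
Qed.

(** r is a true difference of exponents, possibly negative, and s its truncated counterpart; hence
    the inequality between them. *)
Lemma logn_pow_ge (q z x n s : nat) (al D r : R) : 0 <= al -> (0 < n)%N -> 0 <= D ->
  D <= n%:R * ln x%:R -> al * ln x%:R <= (logn q z)%:R * ln q%:R -> r <= s%:R ->
  al * D * (r / n%:R) <= (logn q (z ^ s))%:R * ln q%:R.
Proof.
move=> al0 n0 D0 hD hz rs; have n0' : 0 < n%:R :> R by rewrite ltr0n.
apply: (@le_trans _ _ (al * D * (s%:R / n%:R))).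
  by rewrite ler_wpM2l ?mulr_ge0 // ler_pM2r ?invr_gt0.
rewrite lognX natrM -!mulrA.
apply: (@le_trans _ _ (s%:R * (al * ln x%:R))); last by rewrite ler_wpM2l.
have -> : al * (D * (s%:R / n%:R)) = s%:R * (al * (D / n%:R)) by ring.
by rewrite ler_wpM2l // ler_wpM2l // ler_pdivrMr // mulrC.
Qed.

Lemma logn_mono_x q al D D' d P i k : 0 <= al -> 0 <= D ->
  height_window D D' d P ->
  all (fun p => al * ln p.1%:R <= (logn q p.1)%:R * ln q%:R) P ->
  size k = size d -> i \in box d -> (0 < mono P d i k)%N ->
  al * D * (weighted_sum i (weights d) - weighted_sum k (weights d)) <=
  (logn q (mono P d i k))%:R * ln q%:R.
Proof.
move=> al0 D0; elim: d P i k => [|n d IH] [|[x y] P] //.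
  by move=> [|a i] [|b k] // *; rewrite /= subrr mulr0 logn1 mul0r.
move=> [|a i] [|b k] //; first by rewrite mem_box_cons_nil.
move=> /= /andP[/and4P[n0 _ hD _] hw] /andP[hx hP] [sk]; rewrite mem_box_cons => /andP[an hi].
rewrite muln_gt0 => /andP[m1 m2].
rewrite lognMr //; move: m1; rewrite !muln_gt0 => /andP[/andP[m1 m3] m4].
rewrite !lognMr ?muln_gt0 ?m1 //.
have h1 := IH _ _ _ hw hP sk hi m2.
have rs : a%:R - b%:R <= (a - b)%:R :> R.
  by rewrite lerBlDr -natrD ler_nat; lia.
have h2 := logn_pow_ge al0 n0 D0 hD hx rs.
have h3 := logn_ln_ge0 q 'C(a, b); have h4 := logn_ln_ge0 q (y ^ (n - a)).
have -> : al * D * (a%:R / n%:R + weighted_sum i (weights d) - (b%:R / n%:R + weighted_sum k (weights d))) =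
  al * D * ((a%:R - b%:R) / n%:R) + al * D * (weighted_sum i (weights d) - weighted_sum k (weights d)) by ring.
lra.
Qed.

Lemma logn_mono_y q al D D' d P i k : 0 <= al -> 0 <= D ->
  height_window D D' d P ->
  all (fun p => al * ln p.1%:R <= (logn q p.2)%:R * ln q%:R) P ->
  i \in box d -> (0 < mono P d i k)%N ->
  al * D * ((size d)%:R - weighted_sum i (weights d)) <=
  (logn q (mono P d i k))%:R * ln q%:R.
Proof.
move=> al0 D0; elim: d P i k => [|n d IH] [|[x y] P] //.
  by move=> [|a i] k // *; rewrite /= subrr mulr0 logn1 mul0r.
move=> [|a i] k //; first by rewrite mem_box_cons_nil.
move=> /= /andP[/and4P[n0 _ hD _] hw] /andP[hx hP]; rewrite mem_box_cons => /andP[an hi].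
rewrite muln_gt0 => /andP[m1 m2].
rewrite lognMr //; move: m1; rewrite !muln_gt0 => /andP[/andP[m1 m3] m4].
rewrite !lognMr ?muln_gt0 ?m1 //.
have h1 := IH _ _ _ hw hP hi m2.
have rs : n%:R - a%:R <= (n - a)%:R :> R by rewrite natrB.
have h2 := logn_pow_ge al0 n0 D0 hD hx rs.
have h3 := logn_ln_ge0 q 'C(a, head 0 k); have h4 := logn_ln_ge0 q (x ^ (a - head 0 k)).
have n0' : n%:R != 0 :> R by rewrite pnatr_eq0 -lt0n.
have -> : al * D * ((size d).+1%:R - (a%:R / n%:R + weighted_sum i (weights d))) =
  al * D * ((n%:R - a%:R) / n%:R) + al * D * ((size d)%:R - weighted_sum i (weights d)).
  by rewrite -natr1; field.
lra.
Qed.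

(** * Ridout's theorem for the targets 0, 1 and infinity *)

(** The factor at (x_j - y_j)^(l_j) when a homogenized Taylor coefficient of order k is expanded
    about x_j = y_j. It is to be multiplied by the Taylor coefficient of order k + l at (1, ...,
    1). *)
Fixpoint shifted_coef (P : seq (nat * nat)) (d k l : seq nat) : nat :=
  if P is p :: P' then
    ('C(head 0 k + head 0 l, head 0 k) * (p.1 - p.2) ^ head 0 l *
     p.2 ^ (head 0 d - head 0 k - head 0 l) *
     shifted_coef P' (behead d) (behead k) (behead l))%N
  else 1%N.

Fixpoint addseq (k l : seq nat) : seq nat :=
  if k is a :: k' then (a + head 0 l)%N :: addseq k' (behead l) else [::].

Lemma weighted_sum_addseq k l (w : seq R) : size l = size k ->
  weighted_sum (addseq k l) w = weighted_sum k w + weighted_sum l w.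
Proof.
elim: k l w => [|a k IH] [|b l] w //=; first by rewrite addr0.
by move=> [sl]; rewrite IH // natrD; ring.
Qed.

Lemma size_addseq k l : size (addseq k l) = size k.
Proof. by elim: k l => //= a k IH l; rewrite IH. Qed.

Lemma logn_shifted q al D D' d P k l : 0 <= al -> 0 <= D ->
  height_window D D' d P ->
  all (fun p => al * ln p.1%:R <= (logn q (p.1 - p.2))%:R * ln q%:R) P ->
  l \in box d -> (0 < shifted_coef P d k l)%N ->
  al * D * weighted_sum l (weights d) <= (logn q (shifted_coef P d k l))%:R * ln q%:R.
Proof.
move=> al0 D0; elim: d P k l => [|n d IH] [|[x y] P] //.
  by move=> k [|a l] // *; rewrite /= mulr0 logn1 mul0r.
move=> k [|a l] //; first by rewrite mem_box_cons_nil.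
move=> /= /andP[/and4P[n0 _ hD _] hw] /andP[hx hP]; rewrite mem_box_cons => /andP[an hi].
rewrite muln_gt0 => /andP[m1 m2].
rewrite lognMr //; move: m1; rewrite !muln_gt0 => /andP[/andP[m1 m3] m4].
rewrite !lognMr ?muln_gt0 ?m1 //.
have h1 := IH _ _ _ hw hP hi m2.
have h2 := logn_pow_ge al0 n0 D0 hD hx (lexx a%:R).
have h3 := logn_ln_ge0 q 'C(head 0 k + a, head 0 k).
have h4 := logn_ln_ge0 q (y ^ (n - head 0 k - a)).
have -> : al * D * (a%:R / n%:R + weighted_sum l (weights d)) =
  al * D * (a%:R / n%:R) + al * D * weighted_sum l (weights d) by ring.
lra.
Qed.

(** Binomial expansion of x = y + (x - y), regrouped by C(a, b) C(a - b, l) = C(b + l, b) C(a, b +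
    l). The terms with l > a - b vanish, so the range of l does not depend on a and can be exchanged
    with a sum over a. *)
Lemma binomial_shift (x y n a b : nat) : (y <= x)%N -> (a <= n)%N ->
  ('C(a, b) * x ^ (a - b) * y ^ (n - a) =
   \sum_(l < n.+1) 'C(b + l, b) * (x - y) ^ l * y ^ (n - b - l) * 'C(a, b + l))%N.
Proof.
move=> yx an; have [h|h] := leqP b a; last first.
  rewrite bin_small // !mul0n big1 // => l _.
  by rewrite [X in (_ * X)%N]bin_small ?muln0 // ltn_addr.
have -> : x = (y + (x - y))%N by rewrite subnKC.
have h1 : ((a - b).+1 <= n.+1)%N by rewrite ltnS (leq_trans (leq_subr _ _)).
rewrite {1}Pascal addKn.
rewrite [RHS](bigID (fun l : 'I_n.+1 => (l < (a - b).+1)%N)) /=.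
rewrite [X in (_ = _ + X)%N]big1 ?addn0; last first.
  move=> l; rewrite -leqNgt => hl.
  by rewrite [X in (_ * X)%N]bin_small ?muln0 //; lia.
rewrite -(big_ord_widen n.+1 (fun l => 'C(b + l, b) * (x - y) ^ l * y ^ (n - b - l) * 'C(a, b + l))%N h1).
rewrite big_distrr big_distrl /=; apply: eq_bigr => l _.
have hl : (l <= a - b)%N by rewrite -ltnS.
have E : ('C(a, b) * 'C(a - b, l) = 'C(b + l, b) * 'C(a, b + l))%N.
  apply/eqP; rewrite -(@eqn_pmul2r (b`! * l`! * (a - b - l)`!)) ?muln_gt0 ?fact_gt0 //.
  apply/eqP.
  have e1 := bin_fact h; have e2 := bin_fact hl.
  have hbl : (b + l <= a)%N by lia.
  have e3 := bin_fact hbl; have e4 := bin_fact (leq_addr l b); rewrite addKn in e4.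
  rewrite subnDA in e3.
  transitivity (a`!); first by rewrite -e1 -e2; ring.
  by rewrite -e3 -e4; ring.
have -> : (n - b - l = (a - b - l) + (n - a))%N by lia.
rewrite expnD.
transitivity ('C(a, b) * 'C(a - b, l) * (y ^ (a - b - l) * (x - y) ^ l * y ^ (n - a)))%N; first by ring.
by rewrite E; ring.
Qed.

Lemma mono_expand P d i k : all (fun p => (0 < p.2 < p.1)%N) P -> size P = size d ->
  size k = size d -> i \in box d ->
  (mono P d i k = \sum_(l <- box d) shifted_coef P d k l * multi_bin i (addseq k l))%N.
Proof.
elim: P d i k => [|[x y] P IH] [|n d] // i k.
  by case: k => // _ _ _; rewrite inE => /eqP ->; rewrite big_seq1.
case: k i => [|b k] [|a i] //; first by rewrite mem_box_cons_nil.
move=> /andP[/andP[y0 yx] hP] [sP] [sk]; rewrite mem_box_cons => /andP[an hi].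
rewrite [RHS](big_box n d (fun l => (shifted_coef ((x, y) :: P) (n :: d) (b :: k) l *
  multi_bin (a :: i) (addseq (b :: k) l))%N)) /= (IH d i k) // binomial_shift //; last exact: ltnW.
rewrite big_distrl /=; apply: eq_bigr => u _.
rewrite big_distrr /=; apply: eq_bigr => l _; ring.
Qed.

Lemma mono_le D D' d P i k (s : R) : 0 <= s <= 1 -> height_window D D' d P ->
  all (fun p => ln p.2%:R <= s * ln p.1%:R) P -> i \in box d ->
  (mono P d i k)%:R <= 2 ^+ sumn d *
    expR (D' * (weighted_sum i (weights d) + s * ((size d)%:R - weighted_sum i (weights d)))).
Proof.
move=> /andP[s0 s1]; elim: d P i k => [|n d IH] [|[x y] P] //.
  by move=> [|a i] k // *; rewrite /= expr0 subrr mulr0 addr0 mulr0 expR0 mulr1.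
move=> [|a i] k //; first by rewrite mem_box_cons_nil.
move=> /= /andP[/and4P[n0 /andP[y0 yx] _ hD] hw] /andP[hx hP]; rewrite mem_box_cons => /andP[an hi].
have n0' : 0 < n%:R :> R by rewrite ltr0n.
have x0 : (0 < x)%N by exact: ltn_trans yx.
have an' : a%:R <= n%:R :> R by rewrite ler_nat.
have na' : (n - a)%:R = n%:R - a%:R :> R by rewrite natrB.
have h1 := IH _ _ (behead k) hw hP hi.
have b1 : 'C(a, head 0 k)%:R <= 2 ^+ n :> R.
  rewrite -natrX ler_nat; apply: leq_trans (bin_le_exp2 _ _) _.
  by rewrite leq_exp2l.
have lx0 : 0 <= ln x%:R :> R by rewrite ln_ge0 // ler1n.
have hDx : ln x%:R <= D' / n%:R by rewrite ler_pdivlMr // mulrC.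
have b2 : (x ^ (a - head 0 k))%:R <= expR (D' * (a%:R / n%:R)) :> R.
  apply: (@le_trans _ _ (x ^ a)%:R).
    by rewrite ler_nat leq_pexp2l // leq_subr.
  have xE : x%:R = expR (ln x%:R) :> R by rewrite lnK // posrE ltr0n.
  rewrite natrX xE -expRM_natl ler_expR.
  have -> : D' * (a%:R / n%:R) = a%:R * (D' / n%:R) by ring.
  by rewrite ler_wpM2l.
have b3 : (y ^ (n - a))%:R <= expR (D' * (s * (1 - a%:R / n%:R))) :> R.
  have yE : y%:R = expR (ln y%:R) :> R by rewrite lnK // posrE ltr0n.
  rewrite natrX yE -expRM_natl ler_expR na'.
  apply: (@le_trans _ _ ((n%:R - a%:R) * (s * (D' / n%:R)))).
    rewrite ler_wpM2l ?subr_ge0 //; apply: le_trans hx _.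
    by rewrite ler_wpM2l.
  by rewrite le_eqVlt; apply/orP; left; apply/eqP; field; rewrite gt_eqF.
rewrite !natrM.
have -> : D' * (a%:R / n%:R + weighted_sum i (weights d) + s * ((size d).+1%:R - (a%:R / n%:R + weighted_sum i (weights d)))) =
  D' * (a%:R / n%:R) + D' * (s * (1 - a%:R / n%:R)) +
  D' * (weighted_sum i (weights d) + s * ((size d)%:R - weighted_sum i (weights d))).
  by rewrite -natr1; ring.
rewrite !expRD exprD.
have E (u v A B C : R) : u * v * (A * B * C) = u * A * B * (v * C) by ring.
by rewrite [leRHS]E ler_pM ?mulr_ge0 ?ler_pM.
Qed.

Lemma logn_sum_ge (q : nat) (b : R) (I : eqType) (r : seq I) (c : I -> int) (t : I -> nat) :
  prime q -> \sum_(i <- r) c i * (t i)%:Z != 0 ->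
  (forall i, i \in r -> c i != 0 -> (0 < t i)%N -> b <= (logn q (t i))%:R * ln q%:R) ->
  b <= (logn q `|(\sum_(i <- r) c i * (t i)%:Z : int)|)%:R * ln q%:R.
Proof.
move=> qp; set N := \sum_(i <- r) _ => N0 h.
have lq : 0 < ln q%:R :> R by rewrite ln_gt0 // ltr1n prime_gt1.
rewrite leNgt; apply/negP => hb.
have : (q ^ (logn q `|N|).+1 %| `|N|)%N.
  suff : ((q ^ (logn q `|N|).+1)%:Z %| N)%Z by rewrite dvdzE.
  set E := logn q _ in hb *; rewrite /N big_seq; apply: rpred_sum => i ir.
  have [->|ci] := eqVneq (c i) 0; first by rewrite mul0r dvdz0.
  have [->|ti] := posnP (t i); first by rewrite mulr0 dvdz0.
  apply: dvdz_mull; rewrite dvdzE /= pfactor_dvdn //.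
  have := lt_le_trans hb (h i ir ci ti).
  by rewrite ltr_pM2r // ltr_nat.
by rewrite pfactor_dvdn ?absz_gt0 // ltnn.
Qed.

Lemma ln_prod_prime_powers (S : seq nat) (e : nat -> nat) : all prime S ->
  ln (\prod_(q <- S) q ^ e q)%N%:R = \sum_(q <- S) (e q)%:R * ln q%:R :> R.
Proof.
elim: S => [|q S IH] /=; first by rewrite !big_nil ln1.
move=> /andP[qp pS]; rewrite !big_cons natrM lnM ?posrE ?ltr0n ?expn_gt0 ?(prime_gt0 qp) // ?IH //.
  by rewrite natrX lnXn ?ltr0n ?(prime_gt0 qp) // mulr_natl.
rewrite big_seq; elim/big_ind: _ => [//|a b ha hb|p hp]; first by rewrite muln_gt0 ha.
by rewrite expn_gt0 prime_gt0 // (allP pS).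
Qed.

Lemma sum_logn_le (S : seq nat) (n : nat) : uniq S -> all prime S -> (0 < n)%N ->
  \sum_(q <- S) (logn q n)%:R * ln q%:R <= ln n%:R :> R.
Proof.
move=> uS pS n0; rewrite -ln_prod_prime_powers //.
suff h : (\prod_(q <- S) q ^ logn q n %| n)%N.
  rewrite ler_ln ?posrE ?ltr0n // ?ler_nat; last by apply: dvdn_gt0 h.
  exact: dvdn_leq.
elim: S uS pS => [|q S IH] /=; first by rewrite big_nil.
move=> /andP[qS uS] /andP[qp pS]; rewrite big_cons.
rewrite Gauss_dvd ?pfactor_dvdnn ?IH //.
apply: coprimeXl; rewrite big_seq; elim/big_ind: _ => [|a b|p pS'].
- exact: coprimen1.
- by move=> ha hb; rewrite coprimeMr ha.
apply: coprimeXr; rewrite prime_coprime // dvdn_prime2 ?qp ?(allP pS) //.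
by apply/eqP => e; move: qS; rewrite e pS'.
Qed.

Lemma multi_bin_out d i k : i \in box d -> size k = size d -> k \notin box d -> multi_bin i k = 0%N.
Proof.
elim: d i k => [|n d IH] [|a i] [|b k] //; first by rewrite mem_box_cons_nil.
rewrite !mem_box_cons => /andP[an hi] [sk]; rewrite negb_and => /orP[h|h] /=.
  by rewrite bin_small // (leq_ltn_trans an) // ltnNge.
by rewrite IH // muln0.
Qed.

(* The targets 0, infinity and 1 are labelled 0, 1 and 2. *)
Definition entry (t : nat) (x y : nat) : nat :=
  match t with 0 => x | 1 => y | _ => (x - y)%N end.

(** Common local behaviour: every prime q approaches one fixed target t q with exponent at least al
    q, and s bounds the relative size of y. *)
Definition class_member (S : seq nat) (t : nat -> nat) (al : nat -> R) (s : R)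
    (p : nat * nat) : bool :=
  [&& (0 < p.2 < p.1)%N, coprime p.1 p.2, ln p.2%:R <= s * ln p.1%:R &
    all (fun q => al q * ln p.1%:R <= (logn q (entry (t q) p.1 p.2))%:R * ln q%:R) S].

(** New pairs go to the front, so the head has the greatest height. It will receive the least
    degree, as the outermost variable must. *)
Lemma increasing_heights (G : pred (nat * nat)) (T H : R) (m : nat) : 0 <= T ->
  (forall p, G p -> (0 < p.2 < p.1)%N) ->
  (forall B : nat, exists2 p, G p & (B < p.1)%N) ->
  exists P, [/\ size P = m, all G P, all (fun p => H <= ln p.1%:R) P &
    pairwise (fun p p' => T * ln p'.1%:R <= ln p.1%:R) P].
Proof.
move=> T0 G0 unb; elim: m => [|m [P [sP GP HP pP]]]; first by exists [::].
pose K := Num.max H (T * \sum_(p <- P) ln p.1%:R).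
have [p Gp hp] := unb (Num.truncn (expR K)).+1.
have hK : K <= ln p.1%:R.
  have hp0 : (0 < p.1)%N by exact: leq_ltn_trans hp.
  rewrite -ler_expR lnK ?posrE ?ltr0n //.
  have /andP[_ /ltW h] := truncn_itv (expR_ge0 K).
  by apply: le_trans h _; rewrite ler_nat ltnW.
exists (p :: P); split=> //=; first by rewrite sP.
- by rewrite Gp.
- by rewrite HP andbT; apply: le_trans hK; rewrite le_max lexx.
rewrite pP andbT; apply/allP => p' hp'.
apply: le_trans hK; rewrite le_max; apply/orP; right.
rewrite ler_wpM2l // (big_rem p') //= lerDl big_seq; apply: sumr_ge0 => p2 /mem_rem hp2.
have /andP[h1 h2] := G0 _ (allP GP _ hp2).
by rewrite ln_ge0 // ler1n; exact: leq_ltn_trans h2.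
Qed.

(** * Boundedness of a single class *)

Section Core.
Variables (S : seq nat) (t : nat -> nat) (al : nat -> R) (s de : R).
Hypotheses (S_uniq : uniq S) (S_prime : all prime S) (al0 : forall q, 0 <= al q)
  (s01 : 0 <= s <= 1) (de01 : 0 < de <= 1)
  (al_sum : 1 + s + de <= \sum_(q <- S) al q).

(** With de = 40 ep, the main gain in [final_inequality] is 20 ep, while the losses are at most 7 ep
    and 81 ep^2, where ep <= 1 / 40. *)
Let ep : R := de / 40.

Lemma ep_gt0 : 0 < ep. Proof. by rewrite /ep; have [] := andP de01; lra. Qed.

(* The integer N = sum_i c_i prod_j C(i_j,k_j) x_j^(i_j-k_j) y_j^(d_j-i_j) is, up to
   powers of the y_j, a Taylor coefficient of the auxiliary polynomial at (x_j / y_j). *)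
Lemma padic_lower_bound (D D' : R) (d k : seq nat) (P : seq (nat * nat)) (c : seq nat -> int) :
  let m : R := (size d)%:R in
  let N := \sum_(i <- box d) c i * (mono P d i k)%:Z in
  0 <= D -> height_window D D' d P -> all (class_member S t al s) P ->
  (forall i, c i != 0 -> i \in box d /\ `|weighted_sum i (weights d) - m / 2| <= m * ep) ->
  (forall k, k \in box d -> weighted_sum k (weights d) < m / 2 - m * ep ->
        \sum_(i <- box d) c i * (multi_bin i k)%:Z = 0) ->
  size k = size d -> weighted_sum k (weights d) <= ep -> 0 <= m / 2 - m * ep - ep ->
  N != 0 -> (1 + s + de) * D * (m / 2 - m * ep - ep) <= ln `|N|%N%:R.
Proof.
move=> m N D0 hw cm csupp cvan sk hk Z0 N0.
have kge0 : 0 <= weighted_sum k (weights d) by apply: weighted_sum_ge0; exact: weights_ge0.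
have Ngt0 : (0 < `|N|)%N by rewrite absz_gt0.
have good : all (fun p => (0 < p.2 < p.1)%N) P by apply: sub_all cm => p /and4P[].
apply: le_trans (sum_logn_le S_uniq S_prime Ngt0).
apply: (@le_trans _ _ (\sum_(q <- S) al q * D * (m / 2 - m * ep - ep))).
  by rewrite -mulr_suml -mulr_suml !ler_wpM2r.
rewrite big_seq [leRHS]big_seq; apply: ler_sum => q qS.
have qp := allP S_prime _ qS.
have hq : all (fun p => al q * ln p.1%:R <= (logn q (entry (t q) p.1 p.2))%:R * ln q%:R) P.
  by apply: sub_all cm => p /and4P[_ _ _ /allP]; exact.
have alD : 0 <= al q * D by rewrite mulr_ge0.
have csupp' i : c i != 0 -> m / 2 - m * ep <= weighted_sum i (weights d) <= m / 2 + m * ep.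
  by move=> /csupp[_]; rewrite ler_norml; lra.
move: hq; case: (t q) => [|[|n]] /= hq.
- apply: logn_sum_ge => // i ib ci ti.
  apply: le_trans (logn_mono_x (al0 q) D0 hw hq sk ib ti).
  by rewrite ler_wpM2l //; have := csupp' i ci; lra.
- apply: logn_sum_ge => // i ib ci ti.
  apply: le_trans (logn_mono_y (al0 q) D0 hw hq ib ti).
  by rewrite ler_wpM2l //; have := csupp' i ci; rewrite -/m; have := ler0n R (size d); rewrite -/m; lra.
(* For the target 1 the integer is expanded in powers of x_j - y_j. The coefficient [b l] is a
   Taylor coefficient of order k + l at (1, ..., 1), so it vanishes unless k + l has weight at least
   m / 2 - m ep. *)
pose b l := \sum_(i <- box d) c i * (multi_bin i (addseq k l))%:Z.
have NE : N = \sum_(l <- box d) b l * (shifted_coef P d k l)%:Z.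
  rewrite /N big_seq.
  under eq_bigr => i ib.
    rewrite (mono_expand good (height_window_size hw) sk ib).
    rewrite (big_morph Posz PoszD (erefl _)) mulr_sumr.
    over.
  rewrite -big_seq exchange_big; apply: eq_bigr => l _.
  rewrite /b mulr_suml; apply: eq_bigr => i _.
  by rewrite PoszM; ring.
rewrite NE; apply: logn_sum_ge => //; first by rewrite -NE.
move=> l lb bl tl.
apply: le_trans (logn_shifted (al0 q) D0 hw hq lb tl).
rewrite ler_wpM2l //.
have sl : size l = size k by rewrite sk (size_mem_box lb).
suff : m / 2 - m * ep <= weighted_sum (addseq k l) (weights d) by rewrite weighted_sum_addseq //; lra.
rewrite leNgt; apply: contra bl => hlt; apply/eqP.
(* The order k + l may leave the box, where the vanishing conditions say nothing; there all
   binomials products are 0 by themselves. *)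
have [hin|hout] := boolP (addseq k l \in box d); first exact: cvan.
rewrite /b big_seq big1 // => i ib.
by rewrite (multi_bin_out ib _ hout) ?mulr0 // size_addseq.
Qed.

(** Four factors [2 ^ sumn d] enter: one for the number of terms, two for the coefficients c_i and
    one for the binomials. The rest is the size of a monomial of nearly central weight, largest at
    the upper end because s <= 1. *)
Lemma archimedean_upper_bound (D D' K : R) (d k : seq nat) (P : seq (nat * nat)) (c : seq nat -> int) :
  let m : R := (size d)%:R in
  let N := \sum_(i <- box d) c i * (mono P d i k)%:Z in
  0 <= D' -> height_window D D' d P -> all (class_member S t al s) P ->
  (forall i, c i != 0 -> i \in box d /\ `|weighted_sum i (weights d) - m / 2| <= m * ep) ->
  (forall i, (`|c i| <= size (box d) * 2 ^ sumn d)%N) ->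
  (4 * sumn d)%:R <= K -> N != 0 ->
  ln `|N|%N%:R <= K + D' * (m * (1 + s) / 2 + m * ep).
Proof.
move=> m N D0 hw cm csupp cb hK N0.
have [s0 s1] := andP s01.
have m0 : 0 <= m by [].
have ep0 := ep_gt0.
rewrite -ler_expR lnK ?posrE ?ltr0n ?absz_gt0 //.
set E := D' * _.
have hy : all (fun p => ln p.2%:R <= s * ln p.1%:R) P by apply: sub_all cm => p /and4P[].
have hterm i : i \in box d -> `|c i|%N%:R * (mono P d i k)%:R <=
    (2 ^+ sumn d) ^+ 3 * expR E :> R.
  move=> ib; have [->|ci] := eqVneq (c i) 0.
    by rewrite absz0 mul0r mulr_ge0 ?expR_ge0 ?exprn_ge0.
  have h1 : `|c i|%N%:R <= (2 ^+ sumn d) ^+ 2 :> R.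
    rewrite -!natrX ler_nat; apply: leq_trans (cb i) _.
    by rewrite expnS expn1 leq_mul // size_box_le.
  have h2 := mono_le k s01 hw hy ib.
  rewrite exprSr -mulrA ler_pM //; apply: le_trans h2 _.
  rewrite ler_wpM2l ?exprn_ge0 // ler_expR /E ler_wpM2l // -/m.
  have [_] := csupp i ci; rewrite ler_norml => /andP[_ h3].
  have : (1 - s) * weighted_sum i (weights d) <= (1 - s) * (m / 2 + m * ep).
    by rewrite ler_wpM2l //; lra.
  have : 0 <= s * (m * ep) by rewrite mulr_ge0 // mulr_ge0 // ltW.
  lra.
have h4 : `|N|%N%:R <= \sum_(i <- box d) ((2 ^+ sumn d) ^+ 3 * expR E) :> R.
  have -> : `|N|%N%:R = `|N%:~R| :> R by rewrite -intr_norm -abszE.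
  rewrite /N rmorph_sum /=; apply: le_trans (ler_norm_sum _ _ _) _.
  rewrite big_seq [leRHS]big_seq; apply: ler_sum => i ib.
  apply: le_trans (hterm i ib).
  by rewrite intrM normrM -intr_norm -abszE /= normr_nat.
apply: le_trans h4 _; rewrite sum_const_seq expRD mulrA ler_wpM2r ?expR_ge0 //.
apply: (@le_trans _ _ ((2 ^+ sumn d) ^+ 4)).
  rewrite exprS ler_wpM2r ?exprn_ge0 // -natrX ler_nat; exact: size_box_le.
apply: (@le_trans _ _ (expR (4 * sumn d)%:R)); last by rewrite ler_expR.
rewrite -exprM mulnC; exact: exp2_le_expR.
Qed.

Lemma final_inequality (m D Y : R) : 1 <= m -> 0 < D ->
  (1 + s + de) * D * (m / 2 - m * ep - ep) <= Y ->
  Y <= ep * m * D + (1 + ep) * D * (m * (1 + s) / 2 + m * ep) -> False.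
Proof.
move=> m1 D0 h1 h2; have e0 := ep_gt0; have [s0 s1] := andP s01.
have deE : de = 40 * ep by rewrite /ep; field.
have e1 : ep <= 1 / 40 by rewrite /ep; have [] := andP de01; lra.
have X0 : 0 < m * D by rewrite mulr_gt0 //; lra.
have Z : m * (1 / 2 - 2 * ep) <= m / 2 - m * ep - ep.
  have : ep <= m * ep by rewrite ler_peMl // ltW.
  lra.
have c0 : 0 <= (1 + s + de) * D by rewrite mulr_ge0 ?ltW //; lra.
have h3 := ler_wpM2l c0 Z.
have h4 : (m * D) * ((1 + s + 40 * ep) * (1 / 2 - 2 * ep)) <=
   (m * D) * (ep + (1 + ep) * ((1 + s) / 2 + ep)).
  have -> : (m * D) * ((1 + s + 40 * ep) * (1 / 2 - 2 * ep)) =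
     (1 + s + de) * D * (m * (1 / 2 - 2 * ep)) by rewrite deE; ring.
  apply: (le_trans h3 (le_trans h1 (le_trans h2 _))).
  by rewrite le_eqVlt; apply/orP; left; apply/eqP; ring.
rewrite ler_pM2l // in h4.
have : 0 < ep * (18 - 5 / 2 * (1 + s) - 81 * ep) by rewrite mulr_gt0 //; lra.
have -> : ep * (18 - 5 / 2 * (1 + s) - 81 * ep) =
  (1 + s + 40 * ep) * (1 / 2 - 2 * ep) - (ep + (1 + ep) * ((1 + s) / 2 + ep)) by field.
lra.
Qed.

Lemma class_bounded :
  (forall B : nat, exists2 p, class_member S t al s p & (B < p.1)%N) -> False.
Proof.
move=> unb; have e0 := ep_gt0; have [s0 s1] := andP s01.
have e1 : ep <= 1 / 40 by rewrite /ep; have [] := andP de01; lra.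
(* The number of variables that Chebyshev's inequality asks for in [auxiliary_polynomial]. *)
pose m := (Num.truncn (ep ^+ 2)^-1).+1.
have e20 : 0 < ep ^+ 2 by rewrite exprn_gt0.
have hm : 1 <= m%:R * ep ^+ 2.
  have /andP[_ h] : (Num.truncn (ep ^+ 2)^-1)%:R <= (ep ^+ 2)^-1 < m%:R.
    by apply: truncn_itv; rewrite invr_ge0 ltW.
  by rewrite -ler_pdivrMr // mul1r ltW.
have m1 : 1 <= m%:R :> R by rewrite ler1n.
have [T [T1 HR]] := roth m e0.
(* The first summand gives [T * B <= D] for Roth's lemma; the second makes 4 times the sum of the
   degrees at most ep m D. *)
pose H := 6 * T * m%:R + 8 / ep.
have H8 : 0 < 8 / ep by rewrite divr_gt0.
have HT : 0 <= 6 * T * m%:R by rewrite !mulr_ge0 //; lra.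
have H0 : 0 < H by rewrite /H; lra.
have T20 : 0 <= 2 * T by lra.
have G0 p : class_member S t al s p -> (0 < p.2 < p.1)%N by case/and4P.
(* The gap 2 T between heights yields a gap T between degrees: the factor 2 absorbs the rounding in
   [D' <= 2 * D]. *)
have [P [sP GP HP pP]] := increasing_heights H m T20 G0 unb.
(* D is so large that each ln x_j is at most ep D. Rounding D / ln x_j up to a degree then moves d_j
   ln x_j by at most ep D. *)
pose D := (\sum_(p <- P) ln p.1%:R) / ep : R.
have hH p : p \in P -> H <= ln p.1%:R by exact: (allP HP).
have hp0 p : p \in P -> 0 < ln p.1%:R :> R by move=> /hH; exact: lt_le_trans.
have hpD p : p \in P -> ln p.1%:R <= ep * D.
  move=> pin; rewrite /D mulrC divfK ?gt_eqF // (big_rem p) //= lerDl big_seq.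
  by apply: sumr_ge0 => p2 /mem_rem h; rewrite ltW // hp0.
have [p0 p0P] : exists p, p \in P.
  by case: P sP {GP HP pP D hH hp0 hpD} => // p P _; exists p; rewrite mem_head.
have D0 : 0 < D.
  have := lt_le_trans (hp0 _ p0P) (hpD _ p0P).
  by rewrite pmulr_rgt0.
pose f (p : nat * nat) := (Num.truncn (D / ln p.1%:R)).+1.
pose D' := (1 + ep) * D.
have fD p : p \in P -> D <= (f p)%:R * ln p.1%:R /\ (f p)%:R * ln p.1%:R <= D'.
  move=> pin; have h0 := hp0 _ pin; have hD := hpD _ pin.
  have /andP[h1 h2] : (Num.truncn (D / ln p.1%:R))%:R <= D / ln p.1%:R < (f p)%:R.
    by apply: truncn_itv; rewrite divr_ge0 ?ltW.
  split; first by rewrite -ler_pdivrMr // ltW.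
  rewrite ler_pdivlMr // in h1; rewrite /f -natr1 mulrDl mul1r /D'; lra.
have D'2 : D' <= 2 * D by rewrite /D' ler_wpM2r ?ltW //; lra.
have fB p : p \in P -> (f p)%:R <= 2 * D / H.
  move=> pin; rewrite ler_pdivlMr //.
  have h1 : (f p)%:R * H <= (f p)%:R * ln p.1%:R by rewrite ler_wpM2l // hH.
  have [_ h2] := fD _ pin; lra.
pose d := map f P.
have sd : size d = m by rewrite size_map.
have DH0 : 0 < D / H by rewrite divr_gt0.
(* The length of the auxiliary polynomial is at most the cube of [2 ^ sumn d], two factors from a
   coefficient and one from the number of terms; each degree is at most 2 D / H. *)
pose B := 3 * m%:R * (2 * D / H).
have BE : B = 6 * m%:R * (D / H) by rewrite /B; ring.
have hTB : T * B <= D.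
  have -> : T * B = (6 * T * m%:R) * D / H by rewrite /B; ring.
  by rewrite ler_pdivrMr // mulrC ler_wpM2l ?ltW // /H; lra.
have DH2 : 2 * D / H <= B.
  rewrite BE; have -> : 2 * D / H = 2 * (D / H) by ring.
  by rewrite ler_wpM2r ?ltW //; lra.
have dB : all (fun k : nat => k%:R <= 2 * D / H) d.
  by rewrite all_map; apply/allP => p /fB.
have hd : all (fun k => 0 < k)%N d by rewrite all_map; apply/allP.
have hw : height_window D D' d P.
  rewrite /d; have : {subset P <= P} by [].
  elim: {1 3 4}P => //= p Q IH sub.
  have pin : p \in P by apply: sub; rewrite mem_head.
  have [h1 h2] := fD _ pin; rewrite h1 h2.
  have -> := G0 _ (allP GP _ pin); rewrite /=.
  by apply: IH => q qQ; apply: sub; rewrite in_cons qQ orbT.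
have cfg : roth_config T B d P.
  apply/and5P; split=> //.
  - by apply: sub_all GP => p /and4P[-> ->].
  - rewrite /d; have : {subset P <= P} by [].
    elim: {1 2 4}P pP => //= p Q IH /andP[hpQ pQ] sub.
    have sub' : {subset Q <= P} by move=> q qQ; apply: sub; rewrite in_cons qQ orbT.
    rewrite IH // andbT all_map; apply/allP => p' hp' /=.
    have pin : p \in P by apply: sub; rewrite mem_head.
    have pin' := sub' _ hp'.
    have hh := allP hpQ _ hp'; rewrite /= in hh.
    have [_ h2] := fD _ pin; have [h3 _] := fD _ pin'.
    rewrite -(ler_pM2r (hp0 _ pin')); apply: le_trans h3.
    have h4 : (f p)%:R * (2 * T * ln p'.1%:R) <= (f p)%:R * ln p.1%:R by rewrite ler_wpM2l.
    lra.
  - by apply: sub_all dB => k hk; apply: le_trans hk DH2.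
  - rewrite /d; have : {subset P <= P} by [].
    elim: {1 3 4}P => //= p Q IH sub.
    have pin : p \in P by apply: sub; rewrite mem_head.
    have [h1 _] := fD _ pin; rewrite (le_trans hTB h1) /=.
    by apply: IH => q qQ; apply: sub; rewrite in_cons qQ orbT.
have B1 : 1 <= B.
  by apply: le_trans DH2; apply: le_trans (fB _ p0P); rewrite ler1n.
have hm' : 1 <= (size d)%:R * ep ^+ 2 by rewrite sd.
have [c [[i0 i0b ci0] csupp cb cvan]] := auxiliary_polynomial hd e0 hm'.
pose cR i : R := (c i)%:~R.
have sumd : (sumn d)%:R <= m%:R * (2 * D / H) :> R by have := sumn_le dB; rewrite sd.
have FL : l1norm (poly_of_coefs m d cR) <= expR B.
  have := l1norm_poly_of_coefs d cR; rewrite sd => h; apply: le_trans h _.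
  apply: (@le_trans _ _ (\sum_(i <- box d) (2 ^+ sumn d) ^+ 2)).
    apply: ler_sum => i _; rewrite /cR -intr_norm -abszE /= -!natrX -pmulrn ler_nat.
    apply: leq_trans (cb i) _.
    by rewrite expnS expn1 leq_mul // size_box_le.
  rewrite sum_const_seq; apply: (@le_trans _ _ ((2 ^+ sumn d) ^+ 3)).
    by rewrite [leRHS]exprS ler_wpM2r ?exprn_ge0 // -natrX ler_nat size_box_le.
  have h2 : 2 ^+ (sumn d * 3) <= expR (sumn d * 3)%:R :> R by exact: exp2_le_expR.
  rewrite -exprM; apply: le_trans h2 _; rewrite ler_expR natrM /B; lra.
have F0 : poly_of_coefs m d cR != 0.
  by have := poly_of_coefs_neq0 (c := cR) i0b; rewrite sd; apply; rewrite /cR intr_eq0.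
have FI : integral_coefs (poly_of_coefs m d cR) by apply: integral_coefs_poly_of_coefs => i; rewrite /cR intr_int.
(* Roth's lemma for the index ep gives a non-zero Taylor coefficient whose order has weight below
   ep, a negligible loss in the valuations. *)
have /index_ge_taylor [k [sk hk Tk]] := HR d P B _ sd B1 cfg F0 FI (degree_le_poly_of_coefs _ _ _) FL.
have TE : taylor (points P) k (poly_of_coefs m d cR) = \sum_(i <- box d) cR i * taylor_monomial (points P) i k.
  by have := taylor_poly_of_coefs d cR (points P) k; rewrite sd.
pose N := \sum_(i <- box d) c i * (mono P d i k)%:Z.
have good : all (fun p => (0 < p.2 < p.1)%N) P by apply: sub_all GP => p /G0.
have NE : N%:~R = (ypow P d k)%:R * taylor (points P) k (poly_of_coefs m d cR).
  rewrite TE mulr_sumr /N rmorph_sum /=; apply: eq_big_seq => i ib.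
  by rewrite intrM /cR mulrCA -mono_taylor_monomial ?(height_window_size hw) // -pmulrn.
have N0 : N != 0.
  rewrite -(intr_eq0 R) NE mulf_neq0 //.
  by rewrite pnatr_eq0 -lt0n ypow_gt0.
have sk' : size k = size d by rewrite sk sd.
have mE : (size d)%:R = m%:R :> R by rewrite sd.
have Z0 : 0 <= (size d)%:R / 2 - (size d)%:R * ep - ep.
  have : (size d)%:R * ep <= (size d)%:R * (1 / 40) by rewrite ler_wpM2l.
  rewrite mE; lra.
have low := padic_lower_bound (ltW D0) hw GP csupp cvan sk' (ltW hk) Z0 N0.
have D'0 : 0 <= D' by rewrite /D' mulr_ge0 ?ltW //; lra.
have hK : (4 * sumn d)%:R <= ep * m%:R * D.
  rewrite natrM; apply: (@le_trans _ _ (m%:R * (8 * (D / H)))); first lra.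
  rewrite [leRHS](_ : _ = m%:R * (ep * D)); last by ring.
  rewrite ler_wpM2l // mulrA ler_pdivrMr //.
  have -> : 8 * D = ep * D * (8 / ep) by field; rewrite gt_eqF.
  have epD : 0 <= ep * D by rewrite mulr_ge0 // ltW.
  by rewrite (ler_wpM2l epD) // /H; lra.
have up := archimedean_upper_bound D'0 hw GP csupp cb hK N0.
rewrite mE in low up.
exact: (final_inequality m1 D0 low up).
Qed.

End Core.

(** Pigeonhole, one q at a time: if every value of a bounded function had only bounded heights in
    the set, so would the whole set. *)
Lemma refine_bounded (G : pred (nat * nat)) (F : nat -> nat * nat -> nat) (K : nat) (S : seq nat) :
  uniq S -> (forall B : nat, exists2 p, G p & (B < p.1)%N) ->
  (forall q p, q \in S -> G p -> (F q p <= K)%N) ->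
  exists v : nat -> nat, forall B : nat,
    exists2 p, G p && all (fun q => F q p == v q) S & (B < p.1)%N.
Proof.
move=> uS unb; elim: S uS => [|q S IH] uS hF.
  by exists id => B; have [p h1 h2] := unb B; exists p; rewrite ?h1.
have [qS uS'] := andP uS.
have [|v hv] := IH uS'; first by move=> q' p hq'; apply: hF; rewrite in_cons hq' orbT.
apply: contrapT => H.
have bounded (w : 'I_K.+1) : exists B : nat, forall p,
    G p && all (fun q' => F q' p == v q') S -> F q p = w -> (p.1 <= B)%N.
  apply: contrapT => h2; apply: H.
  exists (fun q' => if q' == q then nat_of_ord w else v q') => B.
  apply: contrapT => h3; apply: h2; exists B => p /andP[h4 h5] h6.
  rewrite leqNgt; apply/negP => h7; apply: h3; exists p => //=.
  rewrite h4 eqxx h6 eqxx /=; apply/allP => q' q'S.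
  have -> : (q' == q) = false by apply: contraNF qS => /eqP <-.
  exact: (allP h5).
have [b hb] := choice bounded.
have [p hp hlt] := hv (\max_(w < K.+1) b w)%N.
have hFp : (F q p < K.+1)%N.
  by rewrite ltnS; apply: hF; [rewrite mem_head|case/andP: hp].
have := hb (Ordinal hFp) p hp erefl.
rewrite leqNgt => /negP; apply; apply: leq_ltn_trans hlt.
exact: (leq_bigmax (Ordinal hFp)).
Qed.

Lemma logn_ln_le (q n : nat) : prime q -> (0 < n)%N -> (logn q n)%:R * ln q%:R <= ln n%:R :> R.
Proof.
move=> qp n0; have uq : uniq [:: q] by [].
have pq : all prime [:: q] by rewrite /= qp.
have : \sum_(p <- [:: q]) (logn p n)%:R * ln p%:R <= ln n%:R :> R by exact: sum_logn_le.
by rewrite big_seq1.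
Qed.

(** The value 2 also covers primes dividing none of x, y, x - y; their valuation there is 0. *)
Definition prime_side (q : nat) (p : nat * nat) : nat :=
  if (q %| p.1)%N then 0 else if (q %| p.2)%N then 1 else 2.

(** Since x and y are coprime, q divides at most one of x, y, x - y, so a single target carries the
    whole valuation. *)
Lemma logn_prime_side q x y : prime q -> (0 < y < x)%N -> coprime x y ->
  (logn q x + logn q y + logn q (x - y) = logn q (entry (prime_side q (x, y)) x y))%N.
Proof.
move=> qp /andP[y0 yx] cxy.
have l0 z : ~~ (q %| z)%N -> logn q z = 0%N by move=> h; rewrite lognE (negPf h) !andbF.
have nxy : ~~ ((q %| x)%N && (q %| y)%N).
  by rewrite -dvdn_gcd (eqP cxy) dvdn1; apply: contraTneq qp => ->.
rewrite /prime_side /=; case: ifP nxy => [qx /= qy|/negbT qx _].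
  rewrite (l0 y qy) (l0 (x - y)%N) ?addn0 //.
  by rewrite (dvdn_subr (ltnW yx)).
rewrite (l0 x qx) add0n; case: ifP => [qy|/negbT qy]; rewrite /=.
  by rewrite (l0 (x - y)%N) ?addn0 // dvdn_subl // ltnW.
by rewrite (l0 y qy).
Qed.

(** Unbounded exceptions would stay unbounded in one of finitely many classes, obtained by fixing
    the target of each prime, then its exponent and the relative size of y up to 1 / n. This
    contradicts [class_bounded]. *)
Theorem ridout (S : seq nat) (de : R) : uniq S -> all prime S -> 0 < de ->
  exists B : nat, forall x y, (0 < y < x)%N -> coprime x y ->
    ln x%:R + ln y%:R + de * ln x%:R <=
      \sum_(q <- S) (logn q x + logn q y + logn q (x - y))%:R * ln q%:R -> (x <= B)%N.
Proof.
move=> uS pS de0; apply: contrapT => H.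
pose de1 := Num.min de 1.
have de10 : 0 < de1 by rewrite lt_min de0 ltr01.
have de11 : de1 <= 1 by rewrite ge_min lexx orbT.
have de1e : de1 <= de by rewrite ge_min lexx.
pose G (p : nat * nat) := [&& (2 < p.1)%N, (0 < p.2 < p.1)%N, coprime p.1 p.2 &
  ln p.1%:R + ln p.2%:R + de1 * ln p.1%:R <=
      \sum_(q <- S) (logn q p.1 + logn q p.2 + logn q (p.1 - p.2))%:R * ln q%:R].
have unb B : exists2 p, G p & (B < p.1)%N.
  apply: contrapT => h; apply: H; exists (maxn B 2) => x y h1 h2 h3.
  rewrite leqNgt gtn_max; apply/negP => /andP[h4 h5]; apply: h; exists (x, y) => //.
  rewrite /G /= h5 h1 h2 /=; apply: le_trans h3; rewrite lerD2l.
  apply: ler_wpM2r => //.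
  by rewrite ln_ge0 // ler1n; exact: ltn_trans h5.
have lx0 p : G p -> 0 < ln p.1%:R :> R.
  by case/and4P => h _ _ _; rewrite ln_gt0 // ltr1n; exact: ltn_trans h.
have [|t ht] := @refine_bounded G prime_side 2 S uS unb.
  by move=> q p _ _; rewrite /prime_side; case: ifP => // _; case: ifP.
pose G1 p := G p && all (fun q => prime_side q p == t q) S.
(* Rounding costs 1 / n for each prime of S and once more for s, in total at most half of delta. *)
pose n := (Num.truncn (2 * (size S).+1%:R / de1)).+1.
have n0 : 0 < n%:R :> R by rewrite ltr0n.
have hn : (size S).+1%:R / n%:R <= de1 / 2.
  have /andP[_ h] : (Num.truncn (2 * (size S).+1%:R / de1))%:R <= 2 * (size S).+1%:R / de1 < n%:R.
    by apply: truncn_itv; rewrite divr_ge0 ?ltW.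
  rewrite ltr_pdivrMr // in h; rewrite ler_pdivrMr //; lra.
pose lv q p := Num.truncn (n%:R * ((logn q (entry (t q) p.1 p.2))%:R * ln q%:R) / ln p.1%:R : R).
have lvP q p : G p -> (lv q p)%:R <=
    (n%:R * ((logn q (entry (t q) p.1 p.2))%:R * ln q%:R) / ln p.1%:R : R) < (lv q p).+1%:R.
  move=> /lx0 h; apply: truncn_itv; apply: divr_ge0; last exact: ltW.
  by apply: mulr_ge0 => //; exact: logn_ln_ge0.
have [|a ha] := @refine_bounded G1 lv n S uS ht.
  move=> q p qS /andP[Gp _]; have /andP[h _] := lvP q p Gp.
  have qp := allP pS _ qS.
  have /and4P[x2 /andP[y0 yx] cxy _] := Gp.
  have ez : (0 < entry (t q) p.1 p.2 <= p.1)%N.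
    case: (t q) => [|[|u]] /=; first by rewrite leqnn andbT; exact: ltn_trans yx.
      by rewrite y0 ltnW.
    by rewrite subn_gt0 yx leq_subr.
  have [ez0 ez1] := andP ez.
  rewrite -(ler_nat R); apply: le_trans h _; rewrite ler_pdivrMr ?lx0 // ler_wpM2l //.
  apply: le_trans (logn_ln_le qp ez0) _.
  by rewrite ler_ln ?posrE ?ltr0n ?ler_nat // (leq_trans ez0).
pose G2 p := G1 p && all (fun q => lv q p == a q) S.
(* The index q is a dummy: [refine_bounded] takes a family, here over a list with one element. *)
pose hy (q : nat) p := Num.truncn (n%:R * ln p.2%:R / ln p.1%:R : R).
have ly p : G p -> 0 <= (ln p.2%:R : R) <= ln p.1%:R.
  case/and4P => _ /andP[y0 yx] _ _; have x0 := ltn_trans y0 yx.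
  by rewrite ln_ge0 ?ler1n //= ler_ln ?posrE ?ltr0n // ler_nat ltnW.
have hyP q p : G p -> (hy q p)%:R <= (n%:R * ln p.2%:R / ln p.1%:R : R) < (hy q p).+1%:R.
  move=> Gp; have [h1 _] := andP (ly _ Gp); apply: truncn_itv.
  apply: divr_ge0; last by rewrite ltW // lx0.
  by rewrite mulr_ge0.
have [||v hv] := @refine_bounded G2 hy n [:: 0%N] _ ha => //.
  move=> q p _ /andP[/andP[Gp _] _]; have /andP[h _] := hyP q p Gp.
  rewrite -(ler_nat R); apply: le_trans h _; rewrite ler_pdivrMr ?lx0 // ler_wpM2l //.
  by have /andP[] := ly _ Gp.
(* The size of y is rounded up and the exponents al are rounded down, so that every member of the
   class satisfies both bounds. *)
pose s : R := Num.min 1 ((v 0%N).+1%:R / n%:R).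
pose al q : R := (a q)%:R / n%:R.
have al0 q : 0 <= al q by rewrite divr_ge0.
have s01 : 0 <= s <= 1.
  by rewrite /s ge_min lexx /= le_min ler01 divr_ge0.
have de2 : 0 < de1 / 2 <= 1 by apply/andP; split; lra.
have al_sum : 1 + s + de1 / 2 <= \sum_(q <- S) al q.
  have [p /andP[/andP[/andP[Gp h1] h2] /= /andP[/eqP h3 _]] _] := hv 0%N.
  have /and4P[x2 yx cxy hsum] := Gp.
  have h := lx0 _ Gp.
  have /andP[e1 _] := hyP 0%N p Gp; rewrite h3 in e1.
  have hs : s <= ((v 0%N)%:R + 1) / n%:R by rewrite /s ge_min natr1 lexx orbT.
  have hS : \sum_(q <- S) (logn q p.1 + logn q p.2 + logn q (p.1 - p.2))%:R * ln q%:R / ln p.1%:R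
      <= \sum_(q <- S) (al q + n%:R^-1) :> R.
    rewrite big_seq [leRHS]big_seq; apply: ler_sum => q qS.
    have qp := allP pS _ qS.
    have E := logn_prime_side qp yx cxy.
    rewrite -surjective_pairing (eqP (allP h1 _ qS)) in E; rewrite E.
    have /andP[_ /ltW g] := lvP q p Gp; rewrite (eqP (allP h2 _ qS)) -natr1 in g.
    rewrite /al -[X in _ + X]mul1r -mulrDl ler_pdivlMr // mulrC.
    by rewrite !mulrA in g *.
  rewrite -mulr_suml big_split /= sum_const_seq in hS.
  have hsum' : 1 + ln p.2%:R / ln p.1%:R + de1 <= (\sum_(q <- S)
      (logn q p.1 + logn q p.2 + logn q (p.1 - p.2))%:R * ln q%:R) / ln p.1%:R.
    rewrite ler_pdivlMr // !mulrDl mul1r divfK ?gt_eqF //.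
  have e2 : (v 0%N)%:R / n%:R <= ln p.2%:R / ln p.1%:R :> R.
    by rewrite ler_pdivrMr // mulrC mulrA.
  have hn' : ((size S)%:R + 1) / n%:R <= de1 / 2 by rewrite natr1.
  move: hs hn'; rewrite !mulrDl !mul1r => hs hn'; lra.
apply: (@class_bounded S t al s (de1 / 2) uS pS al0 s01 de2 al_sum) => B.
have [p /andP[/andP[/andP[Gp h1] h2] /= /andP[/eqP h3 _]] hB] := hv B; exists p => //.
have h := lx0 _ Gp; have /and4P[x2 yx cxy hsum] := Gp.
apply/and4P; split=> //.
- have /andP[_ /ltW g] := hyP 0%N p Gp; rewrite h3 in g.
  rewrite -ler_pdivrMr // /s le_min ler_pdivrMr // mul1r.
  have /andP[_ ->] := ly _ Gp; rewrite /= ler_pdivlMr // mulrC mulrA; exact: g.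
- apply/allP => q qS; have /andP[g _] := lvP q p Gp.
  rewrite (eqP (allP h2 _ qS)) ler_pdivlMr // in g.
  by rewrite /al mulrAC ler_pdivrMr // [leRHS]mulrC.
Qed.

(** * Three consecutive terms of a recurrence *)

Lemma ln_prime_part (S : seq nat) (n : nat) : uniq S -> all prime S ->
  ln (n`_[pred p in S])%:R <= \sum_(q <- S) (logn q n)%:R * ln q%:R :> R.
Proof.
move=> uS pS.
pose r := [seq p <- iota 0 n.+1 | p \in S].
have rS p : p \in r -> p \in S by rewrite mem_filter => /andP[].
have -> : (n`_[pred p in S] = \prod_(p <- r) p ^ logn p n)%N.
  by rewrite big_filter /partn /index_iota subn0; apply: eq_bigl.
rewrite ln_prod_prime_powers; last by apply/allP => p /rS; exact: (allP pS).
have pr : perm_eq r [seq p <- S | (p < n.+1)%N].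
  apply: uniq_perm; rewrite ?filter_uniq ?iota_uniq // => p.
  by rewrite !mem_filter mem_iota add0n /= andbC.
rewrite (perm_big _ pr) /= big_filter [leRHS](bigID (fun p => (p < n.+1)%N)) /= lerDl.
by apply: sumr_ge0 => p _; exact: logn_ln_ge0.
Qed.

(** Required only from some index on, since the recurrence for the |p_k| holds once the signs of the
    p_k have settled. *)
Definition recurrent_tail (n : nat -> nat) := exists K, forall k, (K <= k)%N ->
  [/\ (0 < n k)%N, coprime (n k) (n k.+1) &
      exists2 a, (0 < a)%N & n k.+2 = (a * n k.+1 + n k)%N].

Definition diverges (n : nat -> nat) := forall B, exists K, forall k, (K <= k)%N -> (B < n k)%N.

Definition log_growth (mu : R) (n : nat -> nat) := forall eta : R, 0 < eta ->
  exists K, forall k, (K <= k)%N -> ln (n k.+1)%:R <= (mu - 1 + eta) * ln (n k)%:R.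

Lemma recurrent_le n K : (forall k, (K <= k)%N ->
  [/\ (0 < n k)%N, coprime (n k) (n k.+1) &
      exists2 a, (0 < a)%N & n k.+2 = (a * n k.+1 + n k)%N]) ->
  forall k, (K < k)%N -> (n k <= n k.+1)%N.
Proof.
move=> h [|k] // hk; have [_ _ [a a0 ->]] := h k hk.
by apply: leq_trans (leq_addr _ _); rewrite leq_pmull.
Qed.

(** Growth with eta = 1 / 2 and monotonicity give mu - 1 / 2 >= 1. The bound fixes the signs of mu +
    1 and of mu - 1 + eta / 2 in later estimates. *)
Lemma growth_exponent_ge mu n : recurrent_tail n -> diverges n -> log_growth mu n ->
  3 / 2 <= mu.
Proof.
move=> [K1 h1] h2 h3; have [K2 {}h2] := h2 1%N.
have half : 0 < 1 / 2 :> R by lra.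
have [K3 {}h3] := h3 _ half.
pose k := (K1 + K2 + K3).+1.
have g1 : (n k <= n k.+1)%N by apply: (recurrent_le h1); rewrite /k; lia.
have g2 : (1 < n k)%N by apply: h2; rewrite /k; lia.
have g3 : ln (n k.+1)%:R <= (mu - 1 + 1 / 2) * ln (n k)%:R by apply: h3; rewrite /k; lia.
have l0 : 0 < ln (n k)%:R :> R by rewrite ln_gt0 // ltr1n.
have l1 : ln (n k)%:R <= ln (n k.+1)%:R :> R.
  by rewrite ler_ln ?posrE ?ltr0n ?ler_nat //; lia.
have : 1 * ln (n k)%:R <= (mu - 1 + 1 / 2) * ln (n k)%:R by rewrite mul1r; lra.
rewrite ler_pM2r //; lra.
Qed.

Lemma triple_prime_part (S : seq nat) (mu : R) (n : nat -> nat) :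
  uniq S -> all prime S -> recurrent_tail n -> diverges n -> log_growth mu n ->
  forall eps : R, 0 < eps -> exists K, forall k, (K <= k)%N ->
    (0 < n k * n k.+1 * n k.+2)%N /\
    \sum_(q <- S) (logn q (n k * n k.+1 * n k.+2))%:R * ln q%:R <
    (mu / (mu + 1) + eps) * ln (n k * n k.+1 * n k.+2)%N%:R.
Proof.
move=> uS pS hr hd hg eps e0.
have mu32 := growth_exponent_ge hr hd hg.
have [K1 h1] := hr.
have de0 : 0 < eps / 2 by lra.
have [B hB] := ridout uS pS de0.
(* This eta makes ln y + ln z + ln x at most (mu + 1) (1 + eps / 2) ln z, where y <= z. *)
have eta0 : 0 < (mu + 1) * eps / 2 by rewrite divr_gt0 // mulr_gt0 //; lra.
have [K2 h2] := hd B; have [K3 h3] := hg _ eta0.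
exists (K1 + K2 + K3).+1 => k hk.
have kK1 : (K1 <= k)%N by lia.
have [y0 cyz [a a0 xE]] := h1 k kK1.
have yz : (n k <= n k.+1)%N by apply: (recurrent_le h1); lia.
have zB : (B < n k.+1)%N by apply: h2; lia.
have gr : ln (n k.+2)%:R <= (mu - 1 + (mu + 1) * eps / 2) * ln (n k.+1)%:R.
  by apply: h3; lia.
move: y0 cyz xE yz zB gr; move: (n k) (n k.+1) (n k.+2) => y z x.
move=> y0 cyz xE yz zB gr.
have z0 : (0 < z)%N by exact: leq_trans yz.
have yx : (y < x)%N by rewrite xE -[X in (X < _)%N]add0n ltn_add2r muln_gt0 a0.
have x0 : (0 < x)%N by exact: ltn_trans yx.
split; first by rewrite !muln_gt0 y0 z0 x0.
pose g := gcdn x y.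
have g0 : (0 < g)%N by rewrite gcdn_gt0 x0.
have [x' xx'] := dvdnP (dvdn_gcdl x y); have [y' yy'] := dvdnP (dvdn_gcdr x y).
rewrite -/g in xx' yy'.
have cxy' : coprime x' y'.
  by rewrite /coprime -(eqn_pmul2r g0) mul1n muln_gcdl -xx' -yy' -/g.
have y'0 : (0 < y')%N by move: y0; rewrite yy' muln_gt0 => /andP[].
have yx' : (y' < x')%N by move: yx; rewrite xx' yy' ltn_pmul2r.
have cgz : coprime g z by apply: coprime_dvdl cyz; exact: dvdn_gcdr.
(* g divides x - y = a z and is coprime to z. Hence z still divides the difference after division by
   g. *)
have ga : (g %| a)%N.
  rewrite -(Gauss_dvdl _ cgz) -(addnK y (a * z)%N) -xE.
  by rewrite dvdn_sub ?dvdn_gcdl ?dvdn_gcdr.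
have [a' aa'] := dvdnP ga.
have a'0 : (0 < a')%N by move: a0; rewrite aa' muln_gt0 => /andP[].
have dE : (x' - y' = a' * z)%N.
  apply/eqP; rewrite -(eqn_pmul2r g0) mulnBl -xx' -yy' xE addnK aa'; apply/eqP; ring.
have zd : (z <= x' - y')%N by rewrite dE leq_pmull.
(* A large g could make x' small in comparison with x, but x' is at least x' - y' and hence at least
   z. *)
have Bx' : (B < x')%N by apply: leq_trans zB (leq_trans zd (leq_subr _ _)).
have lnat m : (0 < m)%N -> 0 <= ln m%:R :> R by move=> h; rewrite ln_ge0 // ler1n.
have lnM' u v : (0 < u)%N -> (0 < v)%N -> ln (u * v)%N%:R = ln u%:R + ln v%:R :> R.
  by move=> u0 v0; rewrite natrM lnM // posrE ltr0n.
have x'0 : (0 < x')%N by exact: ltn_trans yx'.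
have ylx : (0 < y' < x')%N by rewrite y'0.
have rid : \sum_(q <- S) (logn q x' + logn q y' + logn q (x' - y'))%:R * ln q%:R <
    ln x'%:R + ln y'%:R + eps / 2 * ln x'%:R.
  by rewrite ltNge; apply: contraL Bx' => /(hB _ _ ylx cxy'); rewrite -leqNgt.
have lg : \sum_(q <- S) (logn q g)%:R * ln q%:R <= ln g%:R :> R by exact: sum_logn_le.
(* The common factor g counts twice, once in x and once in y. Bounded by 2 ln g, it restores ln x +
   ln y from ln x' + ln y'. *)
have step : \sum_(q <- S) (logn q (y * z * x))%:R * ln q%:R <=
    \sum_(q <- S) (logn q x' + logn q y' + logn q (x' - y'))%:R * ln q%:R +
    2 * \sum_(q <- S) (logn q g)%:R * ln q%:R :> R.
  rewrite mulr_sumr -big_split /= big_seq [leRHS]big_seq; apply: ler_sum => q qS.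
  have lq : 0 <= ln q%:R :> R by apply: lnat; apply: prime_gt0; exact: (allP pS).
  rewrite mulrA -mulrDl ler_wpM2r // -natrM -natrD ler_nat.
  rewrite !lognM ?muln_gt0 ?y0 // xx' yy' !lognM //.
  have : (logn q z <= logn q (x' - y'))%N.
    by rewrite dE lognM // leq_addl.
  lia.
have lx : ln x%:R = ln x'%:R + ln g%:R :> R by rewrite xx' lnM'.
have ly : ln y%:R = ln y'%:R + ln g%:R :> R by rewrite yy' lnM'.
have lyz : ln y%:R <= ln z%:R :> R by rewrite ler_ln ?posrE ?ltr0n ?ler_nat.
have l1 := lnat _ g0; have l2 := lnat _ y0; have l3 := lnat _ z0; have l4 := lnat _ x0.
rewrite !lnM' ?muln_gt0 ?y0 //.
set Q := ln y%:R + ln z%:R + ln x%:R.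
have mu1 : 0 < mu + 1 by lra.
(* The S-part is bounded by Q - ln z up to small terms, so a lower bound for ln z in terms of Q is
   what remains. *)
have hQ : Q / (mu + 1) <= ln z%:R + eps / 2 * ln z%:R.
  rewrite ler_pdivrMr // /Q; lra.
have -> : (mu / (mu + 1) + eps) * Q = Q - Q / (mu + 1) + eps * Q by field; rewrite gt_eqF.
have hx' : eps / 2 * ln x'%:R <= eps / 2 * ln x%:R by apply: ler_wpM2l; [exact: ltW|rewrite lx; lra].
have e1 : 0 <= eps / 2 * ln y%:R by rewrite mulr_ge0 // ltW.
have e2 : 0 <= eps / 2 * ln z%:R by rewrite mulr_ge0 // ltW.
have e3 : 0 <= eps / 2 * ln x%:R by rewrite mulr_ge0 // ltW.
have -> : eps * Q = 2 * (eps / 2 * ln y%:R) + 2 * (eps / 2 * ln z%:R) + 2 * (eps / 2 * ln x%:R).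
  by rewrite /Q; field.
move: hQ; rewrite {2}/Q => hQ; lra.
Qed.

(** * Continued fractions *)

(* Numerator and denominator of the convergent of index k. *)
Fixpoint cf_pair (k : nat) (theta : R) : int * int :=
  let a := Num.floor theta in
  if k is k'.+1 then
    let nd := cf_pair k' (theta - a%:~R)^-1 in (a * nd.1 + nd.2, nd.1)
  else (a, 1).

Definition irr (theta : R) := forall r : rat, theta <> ratr r.

Lemma irr_tail (theta : R) : irr theta ->
  [/\ irr (theta - (Num.floor theta)%:~R)^-1, 1 < (theta - (Num.floor theta)%:~R)^-1 &
      0 < theta - (Num.floor theta)%:~R].
Proof.
move=> ht; set a := Num.floor theta.
have /andP[h1 h2] := floor_itv theta; rewrite -/a in h1 h2.
have h0 : 0 < theta - a%:~R.
  rewrite subr_gt0 lt_neqAle h1 andbT; apply/eqP => E.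
  by apply: (ht a%:~R); rewrite ratr_int.
have h3 : theta - a%:~R < 1 by rewrite intrD in h2; lra.
split=> //; last by rewrite invf_gt1.
move=> r E; apply: (ht (a%:~R + r^-1)).
by rewrite rmorphD /= ratr_int fmorphV /= -E invrK addrC subrK.
Qed.

Lemma cf_pairS k theta : cf_pair k.+1 theta =
  (Num.floor theta * (cf_pair k (theta - (Num.floor theta)%:~R)^-1).1 +
   (cf_pair k (theta - (Num.floor theta)%:~R)^-1).2,
   (cf_pair k (theta - (Num.floor theta)%:~R)^-1).1).
Proof. by []. Qed.

Lemma cf_num_S k theta : (cf_pair k.+1 theta).1 =
  Num.floor theta * (cf_pair k (theta - (Num.floor theta)%:~R)^-1).1 +
  (cf_pair k (theta - (Num.floor theta)%:~R)^-1).2.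
Proof. by []. Qed.

Lemma cf_den_S k theta : (cf_pair k.+1 theta).2 =
  (cf_pair k (theta - (Num.floor theta)%:~R)^-1).1.
Proof. by []. Qed.

Lemma floor_ge1 (theta : R) : 1 < theta -> 1 <= Num.floor theta.
Proof. by move=> h; rewrite floor_ge_int ltW. Qed.

Lemma cf_pair_pos k theta : irr theta ->
  1 <= (cf_pair k theta).2 /\ (1 < theta -> 1 <= (cf_pair k theta).1).
Proof.
elim: k theta => [|k IH] theta ht; first by split=> //; exact: floor_ge1.
have [ht' h1 _] := irr_tail ht; have [i1 i2] := IH _ ht'.
rewrite cf_pairS /=; split; first exact: i2.
move=> /floor_ge1 h; have := i2 h1; nia.
Qed.

Lemma cf_pair_det k theta :
  (cf_pair k.+1 theta).1 * (cf_pair k theta).2 - (cf_pair k theta).1 * (cf_pair k.+1 theta).2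
  = (-1) ^+ k.
Proof.
elim: k theta => [|k IH] theta; first by rewrite /=; ring.
rewrite [cf_pair k.+2 theta]cf_pairS [cf_pair k.+1 theta]cf_pairS exprS -(IH (theta - (Num.floor theta)%:~R)^-1) /=.
ring.
Qed.

(** [cf_pair] peels partial quotients off the front, whereas this recurrence adds one at the end.
    The front step is linear, so a recurrence between pairs of the tail passes to theta with the
    same a. *)
Lemma cf_pair_rec k theta : irr theta -> exists2 a : int, 1 <= a &
  (cf_pair k.+2 theta).1 = a * (cf_pair k.+1 theta).1 + (cf_pair k theta).1 /\
  (cf_pair k.+2 theta).2 = a * (cf_pair k.+1 theta).2 + (cf_pair k theta).2.
Proof.
elim: k theta => [|k IH] theta ht; have [ht' h1 _] := irr_tail ht.
  have [_ h2 _] := irr_tail ht'.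
  exists (Num.floor ((theta - (Num.floor theta)%:~R)^-1 -
     (Num.floor (theta - (Num.floor theta)%:~R)^-1)%:~R)^-1); first exact: floor_ge1.
  by rewrite /=; split; ring.
have [a a1 [e1 e2]] := IH _ ht'; exists a => //.
by rewrite !(cf_num_S _ theta) !(cf_den_S _ theta) e1 e2; split; ring.
Qed.

(** With u the fractional part of theta and n / d a convergent of 1 / u, the new error n theta - (a
    n + d) equals -u times the old error d / u - n: one sign change and a positive factor. *)
Lemma cf_pair_error k theta : irr theta ->
  0 < (-1) ^+ k * ((cf_pair k theta).2%:~R * theta - (cf_pair k theta).1%:~R).
Proof.
elim: k theta => [|k IH] theta ht; have [ht' h1 h0] := irr_tail ht.
  by rewrite /= expr0 !mul1r.
have := IH _ ht'; rewrite cf_pairS /=; set u := theta - _ in h0 *.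
have -> : theta = u + (Num.floor theta)%:~R by rewrite /u subrK.
rewrite -/u; move: (cf_pair k u^-1) => [n d] /= h.
have -> : Num.floor (u + (Num.floor theta)%:~R) = Num.floor theta by rewrite /u subrK.
rewrite exprS intrD intrM.
have -> : -1 * (-1) ^+ k * (n%:~R * (u + (Num.floor theta)%:~R) -
    ((Num.floor theta)%:~R * n%:~R + d%:~R)) = (-1) ^+ k * (d%:~R * u^-1 - n%:~R) * u :> R.
  by field; rewrite gt_eqF.
by rewrite mulr_gt0.
Qed.

Lemma det_coprimez (p q r s : int) n : p * s - r * q = (-1) ^+ n ->
  [/\ coprimez r s, coprimez r p & coprimez s q].
Proof.
set e := (-1) ^+ n => h.
have E : e * (p * s - r * q) = 1 by rewrite h /e -expr2 sqrr_sign.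
by split; apply/coprimezP;
  [exists (- e * q, e * p)|exists (- e * q, e * s)|exists (e * p, - e * r)];
  rewrite /= -E; ring.
Qed.

Lemma convergent_cf k theta : irr theta ->
  convergent theta k = (cf_pair k theta).1%:~R / (cf_pair k theta).2%:~R.
Proof.
elim: k theta => [|k IH] theta ht; first by rewrite /= divr1.
have [ht' h1 _] := irr_tail ht; have [_ /(_ h1) i2] := cf_pair_pos k ht'.
rewrite cf_pairS /= IH // invf_div intrD intrM mulrDl mulfK //.
by rewrite intr_eq0; lia.
Qed.

Lemma conv_num_cf k theta : irr theta -> conv_num theta k = (cf_pair k theta).1.
Proof.
move=> ht; have [h _] := cf_pair_pos k ht.
rewrite /conv_num convergent_cf // coprimeq_num; last by have [] := det_coprimez (cf_pair_det k theta).
by rewrite gtr0_sg ?mul1r //; lia.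
Qed.

Lemma conv_den_cf k theta : irr theta -> conv_den theta k = (cf_pair k theta).2.
Proof.
move=> ht; have [h _] := cf_pair_pos k ht.
rewrite /conv_den convergent_cf // coprimeq_den; last by have [] := det_coprimez (cf_pair_det k theta).
case: eqP => [|_]; first by lia.
by rewrite gtr0_norm //; lia.
Qed.

(** * Growth of the denominators and numerators *)

Definition cf_den_nat (theta : R) (k : nat) : nat := `|(cf_pair k theta).2|%N.
Definition cf_num_nat (theta : R) (k : nat) : nat := `|(cf_pair k theta).1|%N.

Lemma cf_den_nat_pos theta k : irr theta -> (cf_pair k theta).2 = cf_den_nat theta k /\ (0 < cf_den_nat theta k)%N.
Proof. by move=> ht; have [h _] := cf_pair_pos k ht; rewrite /cf_den_nat; lia. Qed.

Lemma cf_den_nat_rec theta k : irr theta -> exists2 a, (0 < a)%N &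
  cf_den_nat theta k.+2 = (a * cf_den_nat theta k.+1 + cf_den_nat theta k)%N.
Proof.
move=> ht; have [a a1 [_ e]] := cf_pair_rec k ht; exists `|a|%N; first by lia.
have [e0 _] := cf_den_nat_pos k ht; have [e1 _] := cf_den_nat_pos k.+1 ht; have [e2 _] := cf_den_nat_pos k.+2 ht.
have ea : a = `|a|%N by lia.
by apply/eqP; rewrite -eqz_nat PoszD PoszM -e0 -e1 -e2 -ea e.
Qed.

Lemma cf_den_nat_recurrent theta : irr theta -> recurrent_tail (cf_den_nat theta).
Proof.
move=> ht; exists 0%N => k _; split; first by have [] := cf_den_nat_pos k ht.
  by have [_ _] := det_coprimez (cf_pair_det k theta); rewrite /coprimez /gcdz.
exact: cf_den_nat_rec.
Qed.

Lemma cf_den_nat_ge theta k : irr theta -> (k <= cf_den_nat theta k)%N.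
Proof.
move=> ht; case: k => // k; elim: k => [|k IH]; first by have [] := cf_den_nat_pos 1 ht.
have [a a0 ->] := cf_den_nat_rec k ht; have [_ h] := cf_den_nat_pos k ht.
have : (cf_den_nat theta k.+1 <= a * cf_den_nat theta k.+1)%N by rewrite leq_pmull.
lia.
Qed.

Lemma cf_den_nat_diverges theta : irr theta -> diverges (cf_den_nat theta).
Proof.
by move=> ht B; exists B.+1 => k hk; exact: leq_trans hk (cf_den_nat_ge k ht).
Qed.

(** Consecutive errors have opposite signs, so the determinant identity writes 1 as a sum of two
    positive terms, one of which is the left-hand side. *)
Lemma cf_approx theta k : irr theta ->
  `|(cf_den_nat theta k)%:R * theta - (cf_pair k theta).1%:~R| * (cf_den_nat theta k.+1)%:R < 1.
Proof.
move=> ht; have h0 := cf_pair_error k ht; have h1 := cf_pair_error k.+1 ht.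
have [e0 p0] := cf_den_nat_pos k ht; have [e1 p1] := cf_den_nat_pos k.+1 ht.
have dt : (cf_pair k.+1 theta).1%:~R * (cf_pair k theta).2%:~R -
    (cf_pair k theta).1%:~R * (cf_pair k.+1 theta).2%:~R = (-1) ^+ k :> R.
  by rewrite -!intrM -rmorphB cf_pair_det rmorphXn /= rmorphN1.
rewrite e0 -pmulrn in h0 dt; rewrite e1 -pmulrn in h1 dt.
have -> : `|(cf_den_nat theta k)%:R * theta - (cf_pair k theta).1%:~R| =
   (-1) ^+ k * ((cf_den_nat theta k)%:R * theta - (cf_pair k theta).1%:~R).
  by rewrite -[RHS]gtr0_norm // normrM normrX normrN1 expr1n mul1r.
rewrite exprS in h1.
have p0' : 0 < (cf_den_nat theta k)%:R :> R by rewrite ltr0n.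
have := mulr_gt0 h1 p0'.
have sq : (-1) ^+ k * (-1) ^+ k = 1 :> R by rewrite -expr2 sqrr_sign.
have E : (-1) ^+ k * ((cf_den_nat theta k)%:R * theta - (cf_pair k theta).1%:~R) * (cf_den_nat theta k.+1)%:R
  + -1 * (-1) ^+ k * ((cf_den_nat theta k.+1)%:R * theta - (cf_pair k.+1 theta).1%:~R) * (cf_den_nat theta k)%:R = 1.
  transitivity ((-1) ^+ k * ((cf_pair k.+1 theta).1%:~R * (cf_den_nat theta k)%:R -
    (cf_pair k theta).1%:~R * (cf_den_nat theta k.+1)%:R) : R); last by rewrite dt.
  ring.
by move: E; lra.
Qed.

(** A jump q_(k+1) > q_k^(mu - 1 + eta) makes the error of p_k / q_k, less than 1 / (q_k q_(k+1)),
    smaller than q_k^(-mu - eta). Infinitely many jumps would raise the exponent to mu + eta. *)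
Lemma cf_den_nat_log_growth theta (mu : R) : irr theta ->
  irrationality_exponent theta = mu%:E -> log_growth mu (cf_den_nat theta).
Proof.
move=> ht hmu eta eta0; apply: contrapT => H.
have unb K : exists2 k, (K <= k)%N &
    (mu - 1 + eta) * ln (cf_den_nat theta k)%:R < ln (cf_den_nat theta k.+1)%:R.
  apply: contrapT => h; apply: H; exists K => k hk; rewrite leNgt; apply/negP => h'.
  by apply: h; exists k.
suff : ((mu + eta)%:E <= irrationality_exponent theta)%E.
  by rewrite hmu lee_fin; lra.
apply: ereal_sup_ubound; exists (mu + eta) => //=.
move=> /finite_seqP [s sE].
(* M bounds every denominator in the supposedly finite set, while a convergent of index above M has
   a denominator above M. *)
pose M := (\sum_(x <- s) `|denq x|)%N.
have [k hk hlt] := unb M.+1.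
have [e0 p0] := cf_den_nat_pos k ht; have [e1 p1] := cf_den_nat_pos k.+1 ht.
have dk : denq (convergent theta k) = cf_den_nat theta k.
  by have := conv_den_cf k ht; rewrite /conv_den => ->.
have : convergent theta k \in s.
  suff : [set` s] (convergent theta k) by [].
  rewrite -sE /=; exists (cf_pair k theta).1, (cf_den_nat theta k); split=> //.
    by rewrite convergent_cf // e0.
  have D0 : 0 < (cf_den_nat theta k)%:R :> R by rewrite ltr0n.
  have D1 : 0 < (cf_den_nat theta k.+1)%:R :> R by rewrite ltr0n.
  have ap := cf_approx k ht.
  have -> : theta - (cf_pair k theta).1%:~R / (cf_den_nat theta k)%:R =
      ((cf_den_nat theta k)%:R * theta - (cf_pair k theta).1%:~R) / (cf_den_nat theta k)%:R.
    by field; rewrite gt_eqF.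
  rewrite normrM [X in _ * X]gtr0_norm ?invr_gt0 // ltr_pdivrMr //.
  apply: (@lt_le_trans _ _ (cf_den_nat theta k.+1)%:R^-1); first by rewrite -[ltRHS]mul1r ltr_pdivlMr.
  have -> : (cf_den_nat theta k)%:R `^ (- (mu + eta)) * (cf_den_nat theta k)%:R =
      expR ((1 - (mu + eta)) * ln (cf_den_nat theta k)%:R) :> R.
    by rewrite /powR gt_eqF // -{2}[(cf_den_nat theta k)%:R]lnK ?posrE // -expRD; congr expR; ring.
  by rewrite -[leLHS]lnK ?posrE ?invr_gt0 // ler_expR lnV ?posrE //; lra.
move=> hin; have : (cf_den_nat theta k <= M)%N.
  by rewrite /M (big_rem _ hin) /= dk absz_nat leq_addr.
by have := cf_den_nat_ge k ht; lia.
Qed.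

Lemma cf_num_nat_close theta k : irr theta ->
  exists2 e : R, `|e| < 1 & (cf_pair k theta).1%:~R = (cf_den_nat theta k)%:R * theta + e.
Proof.
move=> ht; exists ((cf_pair k theta).1%:~R - (cf_den_nat theta k)%:R * theta); last by ring.
rewrite distrC; apply: le_lt_trans (cf_approx k ht); rewrite ler_peMr // ler1n.
by have [] := cf_den_nat_pos k.+1 ht.
Qed.

Lemma cf_num_nat_size theta : irr theta -> exists K, forall k, (K <= k)%N ->
  [/\ 0 < theta * (cf_pair k theta).1%:~R,
      `|theta| / 2 * (cf_den_nat theta k)%:R <= (cf_num_nat theta k)%:R &
      (cf_num_nat theta k)%:R <= 2 * `|theta| * (cf_den_nat theta k)%:R].
Proof.
move=> ht; have t0 : 0 < `|theta|.
  by rewrite normr_gt0; apply/eqP => E; apply: (ht 0); rewrite rmorph0.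
(* Since q_k >= k, from here on the error, less than 1, is below half of |theta| q_k. It changes
   neither the sign of p_k nor its order of magnitude. *)
exists (Num.truncn (2 / `|theta|)).+1 => k hk.
have t20 : 0 <= 2 / `|theta| by rewrite divr_ge0.
have /andP[_ h1] := truncn_itv t20.
have D2 : 2 < `|theta| * (cf_den_nat theta k)%:R.
  rewrite mulrC -ltr_pdivrMr //; apply: lt_le_trans h1 _.
  by rewrite ler_nat; apply: leq_trans hk (cf_den_nat_ge k ht).
have [e e1 E] := cf_num_nat_close k ht.
have NE : (cf_num_nat theta k)%:R = `|(cf_pair k theta).1%:~R| :> R by rewrite -intr_norm -abszE.
rewrite NE E; move: e1; rewrite ltr_norml => /andP[e1 e2].
have D0 : 0 <= (cf_den_nat theta k)%:R :> R by [].
have [tp|tn] := ltP 0 theta.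
  rewrite (gtr0_norm tp) in D2 *.
  have p : 0 < (cf_den_nat theta k)%:R * theta + e by lra.
  by rewrite (gtr0_norm p); split; [rewrite mulr_gt0|lra|lra].
have tn' : theta < 0.
  by rewrite lt_neqAle tn andbT; apply: contraTneq t0 => ->; rewrite normr0 ltxx.
rewrite (ltr0_norm tn') in D2 *.
have p : (cf_den_nat theta k)%:R * theta + e < 0 by lra.
by rewrite (ltr0_norm p); split; [rewrite nmulr_rgt0|lra|lra].
Qed.

Lemma cf_num_nat_diverges theta : irr theta -> diverges (cf_num_nat theta).
Proof.
move=> ht B; have [K h] := cf_num_nat_size ht.
have t0 : 0 < `|theta|.
  by rewrite normr_gt0; apply/eqP => E; apply: (ht 0); rewrite rmorph0.
exists (K + (Num.truncn (2 * B%:R / `|theta|)).+1)%N => k hk.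
have [_ h1 _] := h k (leq_trans (leq_addr _ _) hk).
have x0 : 0 <= 2 * B%:R / `|theta| by rewrite divr_ge0.
have /andP[_ h2] := truncn_itv x0.
rewrite -(ltr_nat R); apply: lt_le_trans h1.
have h3 : 2 * B%:R / `|theta| < (cf_den_nat theta k)%:R.
  apply: lt_le_trans h2 _; rewrite ler_nat; apply: leq_trans (cf_den_nat_ge k ht).
  by apply: leq_trans hk; exact: leq_addl.
rewrite ltr_pdivrMr // in h3; lra.
Qed.

(** For large k consecutive p_k have the sign of theta, so taking absolute values commutes with the
    recurrence. *)
Lemma cf_num_nat_recurrent theta : irr theta -> recurrent_tail (cf_num_nat theta).
Proof.
move=> ht; have [K h] := cf_num_nat_size ht; have [K' h'] := cf_num_nat_diverges ht 0%N.
exists (K + K')%N => k hk.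
have kK : (K <= k)%N by lia.
split; first by apply: h'; lia.
  by have [_ + _] := det_coprimez (cf_pair_det k theta); rewrite /coprimez /gcdz.
have [a a1 [e _]] := cf_pair_rec k ht; exists `|a|%N; first by lia.
have [s0 _ _] := h k kK; have [s1 _ _] := h k.+1 (leqW kK).
rewrite /cf_num_nat e.
have : 0 < (cf_pair k theta).1 * (cf_pair k.+1 theta).1.
  rewrite -(ltr0z R) intrM.
  have := mulr_gt0 s0 s1.
  rewrite mulrACA pmulr_rgt0 //; rewrite -expr2 lt_neqAle sqr_ge0 andbT eq_sym sqrf_eq0.
  by apply: contraTneq s0 => ->; rewrite mul0r ltxx.
move: (cf_pair k theta).1 (cf_pair k.+1 theta).1 => u v uv.
have ap : 0 < a by lia.
rewrite -abszM; have [u0|u0|u0] := ltgtP u 0.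
- rewrite nmulr_rgt0 // in uv.
  have av : a * v < 0 by rewrite pmulr_rlt0.
  by move: (a * v) av => w; lia.
- rewrite pmulr_rgt0 // in uv.
  have av : 0 < a * v by rewrite mulr_gt0.
  by move: (a * v) av => w; lia.
by rewrite u0 mul0r ltxx in uv.
Qed.

Lemma cf_num_nat_log_growth theta (mu : R) : irr theta ->
  irrationality_exponent theta = mu%:E -> log_growth mu (cf_num_nat theta).
Proof.
move=> ht hmu; have gD := cf_den_nat_log_growth ht hmu.
have mu32 := growth_exponent_ge (cf_den_nat_recurrent ht) (cf_den_nat_diverges ht) gD.
have t0 : 0 < `|theta|.
  by rewrite normr_gt0; apply/eqP => E; apply: (ht 0); rewrite rmorph0.
move=> eta eta0; have eta2 : 0 < eta / 2 by lra.
have [K1 h1] := gD _ eta2; have [K2 h2] := cf_num_nat_size ht.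
pose c1 := ln (2 * `|theta|); pose c2 := - ln (`|theta| / 2).
(* Total cost of replacing q_k and q_(k+1) by |p_k| and |p_(k+1)|. It is constant, so the other half
   of eta absorbs it once ln |p_k| >= 2 c / eta. *)
pose c := c1 + (mu - 1 + eta / 2) * c2.
have [K3 h3] := cf_num_nat_diverges ht (Num.truncn (expR (2 * c / eta))).+1.
exists (K1 + K2 + K3)%N => k hk.
have g1 := h1 k (leq_trans (leq_trans (leq_addr _ _) (leq_addr _ _)) hk).
have kK2 : (K2 <= k)%N by lia.
have [_ n1 _] := h2 k kK2; have [_ _ n2] := h2 k.+1 (leqW kK2).
have n3 := h3 k (leq_trans (leq_addl _ _) hk).
have [_ d0] := cf_den_nat_pos k ht; have [_ d1] := cf_den_nat_pos k.+1 ht.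
have d0' : 0 < (cf_den_nat theta k)%:R :> R by rewrite ltr0n.
have d1' : 0 < (cf_den_nat theta k.+1)%:R :> R by rewrite ltr0n.
have n0 : 0 < (cf_num_nat theta k)%:R :> R.
  by apply: lt_le_trans n1; rewrite mulr_gt0 // divr_gt0.
have hc : 2 * c / eta <= ln (cf_num_nat theta k)%:R.
  rewrite -ler_expR lnK ?posrE //.
  have /andP[_ /ltW h] := truncn_itv (expR_ge0 (2 * c / eta)).
  by apply: le_trans h _; rewrite ler_nat ltnW.
have l1 : ln (cf_den_nat theta k)%:R <= ln (cf_num_nat theta k)%:R + c2.
  have : ln (`|theta| / 2 * (cf_den_nat theta k)%:R) <= ln (cf_num_nat theta k)%:R.
    by rewrite ler_ln ?posrE // mulr_gt0 // divr_gt0.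
  by rewrite lnM ?posrE ?divr_gt0 // /c2; lra.
have l2 : ln (cf_num_nat theta k.+1)%:R <= c1 + ln (cf_den_nat theta k.+1)%:R.
  rewrite /c1 -lnM ?posrE ?mulr_gt0 // ler_ln ?posrE ?mulr_gt0 //.
  apply: lt_le_trans (_ : `|theta| / 2 * (cf_den_nat theta k.+1)%:R <= _).
    by rewrite mulr_gt0 // divr_gt0.
  by have [] := h2 k.+1 (leqW kK2).
have m0 : 0 <= mu - 1 + eta / 2 by lra.
have l3 := ler_wpM2l m0 l1.
rewrite ler_pdivrMr // in hc.
move: hc; rewrite /c; lra.
Qed.

Lemma Spart_lt_powR (S : {fset nat}) (M : nat) (e : R) :
  (forall p : nat, p \in S -> prime p) -> (0 < M)%N ->
  \sum_(q <- enum_fset S) (logn q M)%:R * ln q%:R < e * ln M%:R ->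
  (Spart S M%:Z)%:R < ((M%:Z)%:~R : R) `^ e.
Proof.
move=> pS M0 h; have M0' : 0 < M%:R :> R by rewrite ltr0n.
have uS : uniq (enum_fset S) by exact: fset_uniq.
have pS' : all prime (enum_fset S) by apply/allP => p /pS.
have -> : Spart S M%:Z = (M`_[pred p in enum_fset S])%N.
  by rewrite /Spart eqz_nat (negPf (lt0n_neq0 M0)); apply: eq_partn.
rewrite -pmulrn -ltr_ln ?posrE ?powR_gt0 // ?ltr0n ?part_gt0 //.
rewrite ln_powR; apply: le_lt_trans h; exact: ln_prime_part.
Qed.

End Ridout.

Theorem theorem1p6 (R : realType) (theta : R)
    (theta_irr : @irrational R theta)
    (mu : R) (mu_exp : irrationality_exponent theta = mu%:E)
    (S : {fset nat}) (S_prime : forall p : nat, p \in S -> prime p) :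
  let p := conv_num theta in
  let q := conv_den theta in
  (forall eps : R, 0 < eps ->
     \forall k \near \oo,
       (Spart S (q k.-1 * q k * q k.+1))%:R
         < ((q k.-1 * q k * q k.+1)%:~R : R) `^ (mu / (mu + 1) + eps)) /\
  (forall eps : R, 0 < eps ->
     \forall k \near \oo,
       (Spart S `|p k.-1 * p k * p k.+1|)%:R
         < (`|p k.-1 * p k * p k.+1|%:~R : R) `^ (mu / (mu + 1) + eps)).
Proof.
move=> p q.
have ht : irr theta.
  move=> r E; move: theta_irr; rewrite irrationalE => h.
  by apply: (h r Logic.I); exists r.
have uS : uniq (enum_fset S) by exact: fset_uniq.
have pS : all prime (enum_fset S) by apply/allP => x /S_prime.
split=> eps eps0.
- have [K h] := triple_prime_part uS pS (cf_den_nat_recurrent ht) (cf_den_nat_diverges ht)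
    (cf_den_nat_log_growth ht mu_exp) eps0.
  (* Starting at [K.+1] excludes k = 0, where [k.-1] would be truncated, and shifts the index of the
     triple by one. *)
  exists K.+1 => // -[|k] // /h [M0 hM] /=.
  have -> : q k * q k.+1 * q k.+2 = (cf_den_nat theta k * cf_den_nat theta k.+1 * cf_den_nat theta k.+2)%N%:Z.
    rewrite /q !conv_den_cf //.
    have [-> _] := cf_den_nat_pos k ht; have [-> _] := cf_den_nat_pos k.+1 ht.
    by have [-> _] := cf_den_nat_pos k.+2 ht; rewrite !PoszM.
  exact: Spart_lt_powR.
- have [K h] := triple_prime_part uS pS (cf_num_nat_recurrent ht) (cf_num_nat_diverges ht)
    (cf_num_nat_log_growth ht mu_exp) eps0.
  exists K.+1 => // -[|k] // /h [M0 hM] /=.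
  have -> : `|p k * p k.+1 * p k.+2| = (cf_num_nat theta k * cf_num_nat theta k.+1 * cf_num_nat theta k.+2)%N%:Z.
    by rewrite /p !conv_num_cf // -abszE !abszM.
  exact: Spart_lt_powR.
Qed.
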